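(* Given a bigerbe $B$ on $X$ equipped with a trivialisation $t$, there is a rigidly trivialised rigid bundle 2-gerbe $r_1(B,t)$ on $X$, as described in the context (that is, the data described there is a rigid bundle 2-gerbe with a rigid trivialisation), and a morphism $r_1(B,t)\to r_1(B)$ of rigid bundle 2-gerbes over $X$ that is the identity on $Y_1^{[\bullet+1]}$.
   Context: Work in the topological setting (compactly generated Hausdorff spaces, continuous maps and bundles), where a cover is a continuous map admitting local sections around every point of the codomain (alternatively, in a category of manifolds with covers the surjective submersions). ''Bundle'' means principal $U(1)$-bundle and a trivialisation of a bundle is a section. For a cover $Y\to X$, $Y^{[k]}$ is the $k$-fold fibre product, with face maps $d_i$ omitting the $(i+1)$-th factor. On a semisimplicial space, $\delta E=d_0^*E\otimes d_1^*E^*\otimes d_2^*E\otimes\cdots$, sections $s$ induce sections $\delta(s)$, and $\delta^2E$ has a canonical section, written $1$. A bundle gerbe $(E,Y)$ on $X$ is a cover $Y\to X$, a bundle $E\to Y^{[2]}$ and a section $m$ of $\delta E\to Y^{[3]}$ with $\delta(m)=1$. **Rigid bundle 2-gerbe** on $X$: (1) a cover $Y\to X$; (2) a 3-truncated semisimplicial space $Z_\bullet$ and a semisimplicial map $Z_\bullet\to Y^{[\bullet+1]}$ that is a cover in each degree; $Z_n^{[k]}$ is the $k$-fold fibre product of $Z_n$ over $Y^{[n+1]}$, with $\delta_h$, $\delta_v$ the operators $\delta$ for the maps $Z_n^{[k]}\to Z_{n-1}^{[k]}$, resp. $Z_n^{[k]}\to Z_n^{[k-1]}$; (3) a bundle $E\to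 Z_1^{[2]}$ and a section $m$ of $\delta_vE$ making $(E,Z_1)$ a bundle gerbe on $Y^{[2]}$; (4) a section $M$ of $\delta_hE\to Z_2^{[2]}$; (5) $\delta_v(M)=\delta_h(m)$, $\delta_h(M)=1$. A **rigid trivialisation** is: (1) a bundle $F\to Z_0^{[2]}$ with a multiplication making $(F,Z_0)$ a bundle gerbe on $Y$; (2) an isomorphism $E\simeq\delta_h(F)$ on $Z_1^{[2]}$ compatible with the bundle gerbe multiplications; (3) such that the induced isomorphism $\delta_hE\simeq\delta_h^2F$ takes $M$ to the canonical section. The **morphisms** used here: given a rigid bundle 2-gerbe with data $(Y,Z_\bullet,E,m,M)$ and a semisimplicial space $Z'_\bullet$ with a map $Z'_\bullet\to Z_\bullet$ over $Y^{[\bullet+1]}$ (with $Z'_\bullet\to Y^{[\bullet+1]}$ a degreewise cover), pulling back $E,m,M$ gives a rigid bundle 2-gerbe with $Z'_\bullet$ and a morphism from it to the original one, which is the identity on $Y^{[\bullet+1]}$. **Bigerbe** $B=(E,W,Y_1,Y_2)$ on $X$: a commutative square $W\to Y_2$, $W\to Y_1$, $Y_1\to X$, $Y_2\to X$ with all maps, and $W\to Y_1\times_XY_2$, covers; $W^{[k,1]}=W\times_{Y_2}\cdots\times_{Y_2}W$ ($k$ factors) over $Y_1^{[k]}$, and $W^{[k,l]}$ its $l$-fold fibre product over $Y_1^{[k]}$; $\delta_h,\delta_v$ are the operators $\delta$ in the first, resp. second index; a bundle $E\to W^{[2,2]}$ with trivialisations $M$ of $\delta_hE$ and $s$ of $\delta_vE$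 such that $\delta_hM=1$, $\delta_vs=1$ and $\delta_vM=\delta_hs$. A **trivialisation** $t$ of $B$ (Kottke--Melrose) consists of bundles $Q_1\to W\times_{Y_1}W=W^{[1,2]}$, with a trivialisation $t_1$ of $\delta_vQ_1$ satisfying $\delta_v(t_1)=1$, and $Q_2\to W\times_{Y_2}W=W^{[2,1]}$, with a trivialisation $t_2$ of $\delta_hQ_2$ satisfying $\delta_h(t_2)=1$, and an isomorphism $E\otimes\delta_v(Q_2)\simeq\delta_h(Q_1)$ on $W^{[2,2]}$ under which $M\otimes\delta_v(t_2)$ corresponds to the canonical section of $\delta_h^2Q_1$, and $s$ tensored with the canonical section of $\delta_v^2Q_2$ corresponds to $\delta_h(t_1)$. **$r_1(B)$** is the rigid bundle 2-gerbe with $Y=Y_1$, $Z_\bullet=W^{[\bullet+1,1]}$, bundle $E\to W^{[2,2]}=Z_1^{[2]}$, $m=s$, and bundle 2-gerbe multiplication $M$. **$N(L)_\bullet$.** For a semisimplicial space $Z_\bullet$ and a simplicial bundle $L\to Z_1$ (with section $s_L$ of $\delta L$, $\delta s_L=1$, equivalently an associative isomorphism $d_0^*L\otimes d_2^*L\to d_1^*L$), $N(L)_\bullet$ is the semisimplicial space over $Z_\bullet$ with $N(L)_0=Z_0$, $N(L)_1=L$, $N(L)_2=d_0^*L\times_{Z_2}d_2^*L$, and in general $N(L)_n$ the fibre product over $Z_n$ of the pullbacks of $L$ along the $n$ consecutive edges, with outer face maps given by projection and inner face maps using the multiplication defined by $s_L$. **$r_1(B,t)$** has cover $Y_1\to X$,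 semisimplicial space $Z_\bullet=N(Q_2)_\bullet\to W^{[\bullet+1,1]}\to Y_1^{[\bullet+1]}$ (using $t_2$), bundle $E'$ the pullback of $E$ along $Z_1^{[2]}=Q_2\times_{Y_1^{[2]}}Q_2\to W^{[2,2]}$ with pulled-back $s$ and $M$; its rigid trivialisation is given by $Q_1\to Z_0^{[2]}=W^{[1,2]}$ (with $t_1$ as multiplication) and the isomorphism $E'\simeq\delta_h(Q_1)$ obtained from the pullback of $E\otimes\delta_v(Q_2)\simeq\delta_h(Q_1)$ and the canonical trivialisation of the pullback of $\delta_v(Q_2)$ to $Q_2\times_{Y_1^{[2]}}Q_2$. *)

(* Defs.v *)
From HB Require Import structures.
From mathcomp Require Import all_boot all_order all_algebra.
From mathcomp Require Import zify generic_quotient.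
From mathcomp Require Import all_classical reals topology complex.

Set Implicit Arguments.
Unset Strict Implicit.
Unset Printing Implicit Defensive.
Import Order.TTheory GRing.Theory Num.Theory.
Local Open Scope quotient_scope.
Local Open Scope classical_set_scope.
Local Open Scope ring_scope.

(** * Compactly generated Hausdorff spaces *)

(** Open in the compactly generated topology: every trace on a compact set is
    relatively open. *)
Definition kopen (T : topologicalType) : set (set T) :=
  [set O | forall K, compact K -> exists2 U, open U & O `&` K = U `&` K].

Definition cgh (T : topologicalType) : Prop :=
  hausdorff_space T /\ kopen (T := T) `<=` open.

Definition kspace (T : Type) : Type := T.

Section Kspace.
Variable T : topologicalType.

Lemma kopenT : kopen [set: T].
Proof. by move=> K _; exists setT => //; exact: openT. Qed.

Lemma kopenI : setI_closed (@kopen T).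
Proof.
move=> A B kA kB K cK; have [U oU AK] := kA K cK; have [V oV BK] := kB K cK.
exists (U `&` V); first exact: openI.
by rewrite setIIl AK BK -setIIl.
Qed.

Lemma kopen_bigU (I : Type) (f : I -> set T) :
  (forall i, kopen (f i)) -> kopen (\bigcup_i f i).
Proof.
move=> kf K cK; have /choice[U UP] : forall i, exists V : set T,
    open V /\ f i `&` K = V `&` K.
  by move=> i; have [V oV e] := kf i K cK; exists V.
exists (\bigcup_i U i); first by apply: bigcup_open => i _; exact: (UP i).1.
by rewrite !setI_bigcupl; apply: eq_bigcupr => i _; exact: (UP i).2.
Qed.

HB.instance Definition _ := Choice.on (kspace T).
HB.instance Definition _ :=
  isOpenTopological.Build (kspace T) kopenT kopenI kopen_bigU.
End Kspace.

(** A continuous map of compactly generated Hausdorff spaces with local sections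
    around every point of the codomain. *)
Definition is_cover (Y X : topologicalType) (f : Y -> X) : Prop :=
  [/\ cgh Y, cgh X, continuous f &
    forall x : X, exists (U : set X) (s : X -> Y),
      [/\ open U, U x, {within U, continuous s} & {in U, cancel s f}]].

(** Binary and [k]-fold fibre products, formed in compactly generated spaces:
    the subspace of the product, with its compactly generated topology. *)
Section FibreProduct.
Variables (A B C : topologicalType) (f : A -> C) (g : B -> C).

Definition fibprod : topologicalType :=
  kspace (set_type [set p : A * B | f p.1 = g p.2]).

Definition fpair (a : A) (b : B) (e : f a = g b) : fibprod :=
  SigSub (mem_set (e : [set p : A * B | f p.1 = g p.2] (a, b))).
Definition fib1 (p : fibprod) : A := (set_val p).1.
Definition fib2 (p : fibprod) : B := (set_val p).2.

Lemma fib_eq (p : fibprod) : f (fib1 p) = g (fib2 p).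
Proof. exact: (set_mem (valP p)). Qed.

Lemma fibprod_inj (p q : fibprod) : fib1 p = fib1 q -> fib2 p = fib2 q -> p = q.
Proof.
by move=> e1 e2; apply: val_inj; apply: injective_projections.
Qed.
End FibreProduct.

Section FibrePower.
Variables (A B : topologicalType) (f : A -> B).

Definition fibpow (k : nat) : topologicalType :=
  kspace (set_type [set a : {ptws 'I_k -> A} | forall i j, f (a i) = f (a j)]).

Definition fptup k (a : 'I_k -> A) (e : forall i j, f (a i) = f (a j)) :
    fibpow k :=
  SigSub (mem_set (e : [set a : {ptws 'I_k -> A} |
                          forall i j, f (a i) = f (a j)] a)).
Definition fpev k (a : fibpow k) : 'I_k -> A := set_val a.

Lemma fpev_eq k (a : fibpow k) i j : f (fpev a i) = f (fpev a j).
Proof. exact: (set_mem (valP a)). Qed.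

Lemma fibpow_inj k (a b : fibpow k) : fpev a =1 fpev b -> a = b.
Proof. by move=> e; apply: val_inj; apply: funext. Qed.

(** The [i]-th face map omits the factor with index [i] (counted from 0). *)
Definition fpface k (i : 'I_k.+1) (a : fibpow k.+1) : fibpow k :=
  fptup (fun j j' => fpev_eq a (lift i j) (lift i j')).

(** The faces [A^[2] -> A^[1] = A]. *)
Definition fpface1 (i : 'I_2) (a : fibpow 2) : A := fpev (fpface i a) ord0.
End FibrePower.

Section FibrePowerMap.
Variables (A B A' B' : topologicalType) (f : A -> B) (f' : A' -> B').
Variables (g : A -> A') (h : B -> B').
Hypothesis gh : forall a, f' (g a) = h (f a).

Definition fpmap k (a : fibpow f k) : fibpow f' k :=
  fptup (fun i j => etrans (gh (fpev a i))
    (etrans (congr1 h (fpev_eq a i j)) (esym (gh (fpev a j))))).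
End FibrePowerMap.

(** * Principal U(1)-bundles *)

Section U1.
Variable R : realType.

Definition U1 : topologicalType := set_type [set z : R[i]^o | `|z| = 1].

Definition u1_of (z : R[i]) (e : `|z| = 1) : U1 :=
  SigSub (mem_set (e : [set z : R[i]^o | `|z| = 1] z)).
Definition u1_val (u : U1) : R[i] := set_val u.

Lemma u1_norm (u : U1) : `|u1_val u| = 1.
Proof. exact: (set_mem (valP u)). Qed.

Lemma u1_neq0 (u : U1) : u1_val u != 0.
Proof. by rewrite -normr_eq0 u1_norm oner_eq0. Qed.

Lemma u1_inj : injective u1_val.
Proof. by move=> u v e; apply: val_inj. Qed.

Definition u1_one : U1 := u1_of (normr1 _).

Lemma u1_mul_subproof (u v : U1) : `|u1_val u * u1_val v| = 1.
Proof. by rewrite normrM !u1_norm mulr1. Qed.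
Definition u1_mul (u v : U1) : U1 := u1_of (u1_mul_subproof u v).

Lemma u1_inv_subproof (u : U1) : `|(u1_val u)^-1| = 1.
Proof. by rewrite normfV u1_norm invr1. Qed.
Definition u1_inv (u : U1) : U1 := u1_of (u1_inv_subproof u).

Lemma u1_mulA u v w : u1_mul u (u1_mul v w) = u1_mul (u1_mul u v) w.
Proof. by apply: u1_inj; exact: mulrA. Qed.
Lemma u1_mulC u v : u1_mul u v = u1_mul v u.
Proof. by apply: u1_inj; exact: mulrC. Qed.
Lemma u1_mul1 u : u1_mul u u1_one = u.
Proof. by apply: u1_inj; exact: mulr1. Qed.
Lemma u1_mulV u : u1_mul u (u1_inv u) = u1_one.
Proof. by apply: u1_inj; exact: (mulfV (u1_neq0 u)). Qed.
Lemma u1_invK u : u1_inv (u1_inv u) = u.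
Proof. by apply: u1_inj; exact: invrK. Qed.
Lemma u1_invM u v : u1_inv (u1_mul u v) = u1_mul (u1_inv u) (u1_inv v).
Proof. by apply: u1_inj; exact: invfM. Qed.
Lemma u1_inv1 : u1_inv u1_one = u1_one.
Proof. by apply: u1_inj; exact: invr1. Qed.
End U1.
Arguments u1_one {R}.

(** The algebra of a U(1)-bundle, with a topology on the total space: all fibres
    are U(1)-torsors.  The topological conditions are in [principal]; keeping
    them apart allows the constructions below to be written down before they
    are known to produce principal bundles. *)
Record prebundle (R : realType) (X : topologicalType) := Prebundle {
  tot :> topologicalType;
  prj : tot -> X;
  uact : U1 R -> tot -> tot;
  prj_surj : forall x, exists p, prj p = x;
  prj_act : forall u p, prj (uact u p) = prj p;
  uact1 : forall p, uact u1_one p = p;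
  uactM : forall u v p, uact u (uact v p) = uact (u1_mul u v) p;
  uact_free : forall u p, uact u p = p -> u = u1_one;
  uact_trans : forall p q, prj p = prj q -> exists u, q = uact u p }.

Arguments prj {R X} p _ : rename.
Arguments uact {R X p} _ _ : rename.

(** Principal U(1)-bundle of compactly generated Hausdorff spaces.  Local
    triviality: [(x, u) |-> uact u (s x)] is a homeomorphism onto the part of
    the bundle over [U], with inverse [p |-> (prj p, c p)]. *)
Record principal (R : realType) (X : topologicalType) (P : prebundle R X) :
    Prop := {
  principal_cgh : cgh P;
  prj_continuous : continuous (prj P);
  uact_continuous :
    continuous ((fun up => uact up.1 up.2) : kspace (U1 R * P)%type -> P);
  loc_triv : forall x : X, exists (U : set X) (s : X -> P) (c : P -> U1 R),
    [/\ open U, U x, {within U, continuous s} & {in U, cancel s (prj P)}] /\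
    [/\ {within prj P @^-1` U, continuous c},
        forall p, U (prj P p) -> p = uact (c p) (s (prj P p)) &
        forall u p, U (prj P p) -> c (uact u p) = u1_mul u (c p)] }.

Section Bundles.
Context {R : realType}.
Implicit Types (X : topologicalType).

Lemma uact_inj X (P : prebundle R X) u (p q : P) : uact u p = uact u q -> p = q.
Proof.
by move/(congr1 (uact (u1_inv u))); rewrite !uactM u1_mulC u1_mulV !uact1.
Qed.

(** A section, not required to be continuous. *)
Record section X (P : prebundle R X) := Section {
  sec :> X -> P;
  secK : cancel sec (prj P) }.

Lemma some_section_subproof X (P : prebundle R X) :
  {s : X -> P | cancel s (prj P)}.
Proof.
by exists (fun x => sval (cid (prj_surj P x))) => x; case: cid.
Qed.
Definition some_section X (P : prebundle R X) : section P :=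
  Section (svalP (some_section_subproof P)).

(** The element [u] of U(1) with [p = uact u q]. *)
Lemma uratio_subproof X (P : prebundle R X) (p q : P) (e : prj P q = prj P p) :
  {u | p = uact u q}.
Proof. exact: (cid (uact_trans e)). Qed.
Definition uratio X (P : prebundle R X) (p q : P) (e : prj P q = prj P p) :=
  sval (uratio_subproof e).
Lemma uratioP X (P : prebundle R X) (p q : P) (e : prj P q = prj P p) :
  p = uact (uratio e) q.
Proof. exact: (svalP (uratio_subproof e)). Qed.

Lemma uact_regular X (P : prebundle R X) u v (p : P) : uact u p = uact v p -> u = v.
Proof.
move/(congr1 (uact (u1_inv v))).
rewrite !uactM [u1_mul _ v]u1_mulC u1_mulV uact1 => /uact_free e.
by rewrite -[u]u1_mul1 -(u1_mulV v) u1_mulC -u1_mulA [u1_mul _ u]u1_mulC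
  u1_mulC [u1_mul u _]u1_mulC e u1_mulC u1_mul1.
Qed.

(** ** Pullback, dual, tensor product *)

Section Pull.
Variables (X' X : topologicalType) (f : X' -> X) (P : prebundle R X).
Let T : topologicalType := fibprod f (prj P).
Let pr (p : T) : X' := fib1 p.

Let pact_subproof (u : U1 R) (p : T) : f (fib1 p) = prj P (uact u (fib2 p)).
Proof. by rewrite prj_act fib_eq. Qed.
Let pact (u : U1 R) (p : T) : T := fpair (pact_subproof u p).

Let pr_surj x : exists p, pr p = x.
Proof. by have [p e] := prj_surj P (f x); exists (fpair (esym e)). Qed.
Let pr_act u p : pr (pact u p) = pr p.
Proof. by []. Qed.
Let pact1 p : pact u1_one p = p.
Proof. by apply: fibprod_inj => //; exact: uact1. Qed.
Let pactM u v p : pact u (pact v p) = pact (u1_mul u v) p.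
Proof. by apply: fibprod_inj => //; exact: uactM. Qed.
Let pact_free u p : pact u p = p -> u = u1_one.
Proof. by move/(congr1 (@fib2 _ _ _ _ _)); exact: uact_free. Qed.
Let pact_trans p q : pr p = pr q -> exists u, q = pact u p.
Proof.
move=> e; have [|u eu] := @uact_trans _ _ P (fib2 p) (fib2 q).
  by rewrite -!fib_eq -/(pr p) e.
by exists u; apply: fibprod_inj.
Qed.

Definition pull : prebundle R X' :=
  Prebundle pr_surj pr_act pact1 pactM pact_free pact_trans.

Lemma pull_sec_subproof (s : section P) x : f x = prj P (s (f x)).
Proof. by rewrite secK. Qed.
Definition pull_sec (s : section P) : section pull :=
  @Section _ pull (fun x => fpair (pull_sec_subproof s x)) (fun _ => erefl).
End Pull.

Section Dual.
Variables (X : topologicalType) (P : prebundle R X).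
Let dact (u : U1 R) (p : P) : P := uact (u1_inv u) p.

Let dproj_act u p : prj P (dact u p) = prj P p.
Proof. exact: prj_act. Qed.
Let dact1 p : dact u1_one p = p.
Proof. by rewrite /dact u1_inv1 uact1. Qed.
Let dactM u v p : dact u (dact v p) = dact (u1_mul u v) p.
Proof. by rewrite /dact uactM u1_invM. Qed.
Let dact_free u p : dact u p = p -> u = u1_one.
Proof. by move/uact_free => e; rewrite -[u]u1_invK e u1_inv1. Qed.
Let dact_trans p q : prj P p = prj P q -> exists u, q = dact u p.
Proof.
by move/uact_trans => [u ->]; exists (u1_inv u); rewrite /dact u1_invK.
Qed.

Definition dual : prebundle R X :=
  Prebundle (prj_surj P) dproj_act dact1 dactM dact_free dact_trans.
Definition dual_sec (s : section P) : section dual :=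
  @Section _ dual s (secK s).
End Dual.

(** [P (x) Q] is the quotient of the fibre product [P x_X Q] by the
    antidiagonal action of U(1). *)
Section Tensor.
Variables (X : topologicalType) (P Q : prebundle R X).
Let D : topologicalType := fibprod (prj P) (prj Q).

Definition tens_rel (p q : D) : bool :=
  `[< exists u, fib1 q = uact u (fib1 p) /\ fib2 q = uact (u1_inv u) (fib2 p) >].

Let tens_refl : reflexive tens_rel.
Proof. by move=> p; apply/asboolP; exists u1_one; rewrite u1_inv1 !uact1. Qed.
Let tens_sym : symmetric tens_rel.
Proof.
have sub p q : tens_rel p q -> tens_rel q p.
  move=> /asboolP[u [e1 e2]]; apply/asboolP; exists (u1_inv u).
  by rewrite e1 e2 !uactM u1_invK u1_mulV [u1_mul _ u]u1_mulC u1_mulV !uact1.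
by move=> p q; apply/idP/idP; exact: sub.
Qed.
Let tens_trans : transitive tens_rel.
Proof.
move=> q p r /asboolP[u [e1 e2]] /asboolP[v [e3 e4]]; apply/asboolP.
by exists (u1_mul v u); rewrite e3 e1 e4 e2 !uactM u1_invM.
Qed.

Canonical tens_equiv := EquivRel tens_rel tens_refl tens_sym tens_trans.

Let T : topologicalType := quotient_topology {eq_quot tens_equiv}.
Let cls (d : D) : T := \pi_({eq_quot tens_equiv})%qT d.
Let rep (t : T) : D := repr (t : {eq_quot tens_equiv}).

Let repK t : cls (rep t) = t.
Proof. exact: reprK. Qed.
Let clsP p q : reflect (cls p = cls q) (tens_rel p q).
Proof. exact: eqmodP. Qed.

Definition tpure (p : P) (q : Q) (e : prj P p = prj Q q) : T := cls (fpair e).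

Let tproj (t : T) : X := prj P (fib1 (rep t)).
Let tact_subproof u (t : T) :
  prj P (uact u (fib1 (rep t))) = prj Q (fib2 (rep t)).
Proof. by rewrite prj_act fib_eq. Qed.
Let tact u (t : T) : T := tpure (tact_subproof u t).

Let tproj_cls d : tproj (cls d) = prj P (fib1 d).
Proof.
by have /esym/clsP/asboolP[u [e _]] := repK (cls d); rewrite /tproj e prj_act.
Qed.
Let tact_cls u d (e : prj P (uact u (fib1 d)) = prj Q (fib2 d)) :
  tact u (cls d) = tpure e.
Proof.
apply/esym/clsP/asboolP.
have /esym/clsP/asboolP[v [e1 e2]] := repK (cls d).
by exists v; split => //=; rewrite [LHS]/fib1 /= e1 !uactM u1_mulC.
Qed.
Let uact_fib u (d : D) : prj P (uact u (fib1 d)) = prj Q (fib2 d).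
Proof. by rewrite prj_act fib_eq. Qed.

Let tproj_surj x : exists t, tproj t = x.
Proof.
have [p <-] := prj_surj P x; have [q e] := prj_surj Q (prj P p).
by exists (tpure (esym e)); rewrite tproj_cls.
Qed.
Let tproj_act u t : tproj (tact u t) = tproj t.
Proof. by rewrite tproj_cls /fib1 /= prj_act. Qed.
Let tact1 t : tact u1_one t = t.
Proof.
rewrite -[RHS]repK; apply: (congr1 cls).
by apply: fibprod_inj => //; exact: uact1.
Qed.
Let tactM u v t : tact u (tact v t) = tact (u1_mul u v) t.
Proof.
rewrite [tact v t]/tact (tact_cls (uact_fib _ _)); apply: (congr1 cls).
by apply: fibprod_inj => //; exact: uactM.
Qed.
Let tact_free u t : tact u t = t -> u = u1_one.
Proof.
rewrite -[X in _ = X -> _]repK => /clsP/asboolP[v [e1 e2]].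
have /uact_free v1 : uact (u1_inv v) (fib2 (rep t)) = fib2 (rep t) by exact/esym.
have {}v1 : v = u1_one by rewrite -[v]u1_invK v1 u1_inv1.
by move: e1; rewrite v1 uact1 => /esym /uact_free.
Qed.
Let tact_trans t t' : tproj t = tproj t' -> exists u, t' = tact u t.
Proof.
move=> e; have [u eu] := uact_trans e.
have [v ev] : exists v, fib2 (rep t') = uact v (fib2 (rep t)).
  by apply: uact_trans; rewrite -!fib_eq.
exists (u1_mul u v); rewrite -[LHS]repK; apply/esym/clsP/asboolP.
exists (u1_inv v); split; last by rewrite u1_invK.
rewrite [X in uact _ X]/fib1 /= uactM u1_mulC -u1_mulA u1_mulV u1_mul1.
exact: eu.
Qed.

Definition tensor : prebundle R X :=
  Prebundle tproj_surj tproj_act tact1 tactM tact_free tact_trans.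

Lemma prj_tpure p q (e : prj P p = prj Q q) :
  prj tensor (tpure e) = prj P p.
Proof. exact: tproj_cls. Qed.

Lemma uact_tpure u p q (e : prj P p = prj Q q)
    (e' : prj P (uact u p) = prj Q q) :
  uact u (tpure e : tensor) = tpure e'.
Proof. exact: tact_cls. Qed.

Lemma tpureP (t : tensor) : exists p q (e : prj P p = prj Q q), t = tpure e.
Proof.
exists (fib1 (rep t)), (fib2 (rep t)), (fib_eq (rep t)).
by rewrite -[LHS]repK; apply: (congr1 cls); apply: fibprod_inj.
Qed.

Lemma tpure_eq p q p' q' (e : prj P p = prj Q q) (e' : prj P p' = prj Q q')
    u : p' = uact u p -> q' = uact (u1_inv u) q -> tpure e = tpure e'.
Proof. by move=> ep eq; apply/clsP/asboolP; exists u. Qed.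

Definition tens_fst (t : tensor) : P := fib1 (rep t).
Definition tens_snd (t : tensor) : Q := fib2 (rep t).
Lemma tens_fst_snd t : prj P (tens_fst t) = prj Q (tens_snd t).
Proof. exact: fib_eq. Qed.
Lemma tens_fstK t : tpure (tens_fst_snd t) = t.
Proof. by rewrite -[RHS]repK; apply: (congr1 cls); apply: fibprod_inj. Qed.
Lemma prj_tens_fst t : prj P (tens_fst t) = prj tensor t.
Proof. by []. Qed.

Lemma tens_sec_subproof (s : section P) (t : section Q) x :
  prj P (s x) = prj Q (t x).
Proof. by rewrite !secK. Qed.
Lemma tens_secK (s : section P) (t : section Q) :
  cancel (fun x => tpure (tens_sec_subproof s t x)) (prj tensor).
Proof. by move=> x; rewrite prj_tpure secK. Qed.
Definition tens_sec (s : section P) (t : section Q) : section tensor :=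
  Section (tens_secK s t).
End Tensor.

(** ** Bundle maps *)

(** A U(1)-equivariant map covering [g], not required to be continuous. *)
Record bmap X X' (g : X -> X') (P : prebundle R X) (P' : prebundle R X') :=
  Bmap {
    bfun :> P -> P';
    bmap_proj : forall p, prj P' (bfun p) = g (prj P p);
    bmap_act : forall u p, bfun (uact u p) = uact u (bfun p) }.

Definition bundle_iso X (P Q : prebundle R X) (F : bmap id P Q) : Prop :=
  continuous F /\
  exists2 G : Q -> P, continuous G & cancel F G /\ cancel G F.

Definition bmap_sec X (P Q : prebundle R X) (F : bmap id P Q) (s : section P) :
  section Q := @Section _ Q (fun x => F (s x))
    (fun x => etrans (bmap_proj F (s x)) (secK s x)).

Lemma bmap_id_subproof X (P : prebundle R X) (p : P) : prj P p = id (prj P p).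
Proof. by []. Qed.
Definition bmap_id X (P : prebundle R X) : bmap id P P :=
  @Bmap _ _ id P P id (@bmap_id_subproof X P) (fun _ _ => erefl).

Section SecMap.
Variables (X : topologicalType) (P Q : prebundle R X).
Variables (s : section P) (t : section Q).
Let sm_subproof (p : P) : prj P (s (prj P p)) = prj P p.
Proof. exact: secK. Qed.
Let sm (p : P) : Q := uact (uratio (sm_subproof p)) (t (prj P p)).
Let sm_proj p : prj Q (sm p) = id (prj P p).
Proof. by rewrite prj_act secK. Qed.
Let sm_act u p : sm (uact u p) = uact u (sm p).
Proof.
rewrite /sm uactM; congr (uact _ (t _)); last exact: prj_act.
apply: (@uact_regular _ P _ _ (s (prj P (uact u p)))).
rewrite -(uratioP (sm_subproof (uact u p))) prj_act -uactM.
by rewrite -(uratioP (sm_subproof p)).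
Qed.

(** The bundle map over the identity that takes the section [s] to [t]. *)
Definition bmap_of_sec : bmap id P Q := Bmap sm_proj sm_act.
End SecMap.

Section Lift.
Variables (X X' : topologicalType) (g : X -> X').
Variables (P : prebundle R X) (P' : prebundle R X') (F : bmap g P P').

Lemma lift_pt_subproof x (p' : P') (e : prj P' p' = g x) :
  {p | prj P p = x /\ F p = p'}.
Proof.
apply: cid; have [p ep] := prj_surj P x.
have [u eu] : exists u, p' = uact u (F p).
  by apply: uact_trans; rewrite bmap_proj ep.
by exists (uact u p); rewrite prj_act bmap_act.
Qed.
Definition lift_pt x p' (e : prj P' p' = g x) : P := sval (lift_pt_subproof e).
Lemma lift_proj x p' (e : prj P' p' = g x) : prj P (lift_pt e) = x.
Proof. exact: (svalP (lift_pt_subproof e)).1. Qed.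
Lemma lift_ptK x p' (e : prj P' p' = g x) : F (lift_pt e) = p'.
Proof. exact: (svalP (lift_pt_subproof e)).2. Qed.

Lemma bmap_inj p q : prj P p = prj P q -> F p = F q -> p = q.
Proof.
move=> /uact_trans[u ->]; rewrite bmap_act => /esym/uact_free ->.
by rewrite uact1.
Qed.

(** [F] exhibits [P] as the pullback of [P'] along [g]; [lift_sec s'] is the
    pulled-back section, [lift_bmap G] the factorisation of [G] through [F]. *)
Lemma lift_sec_subproof (s' : section P') x : prj P' (s' (g x)) = g x.
Proof. exact: secK. Qed.
Definition lift_sec (s' : section P') : section P :=
  @Section _ P (fun x => lift_pt (lift_sec_subproof s' x))
    (fun x => lift_proj (lift_sec_subproof s' x)).

Variables (Q : prebundle R X) (G : bmap g Q P').
Let lb (q : Q) : P := lift_pt (bmap_proj G q).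
Let lb_proj q : prj P (lb q) = id (prj Q q).
Proof. exact: lift_proj. Qed.
Let lb_act u q : lb (uact u q) = uact u (lb q).
Proof.
apply: bmap_inj; last by rewrite bmap_act !lift_ptK bmap_act.
by rewrite prj_act !lift_proj prj_act.
Qed.
Definition lift_bmap : bmap id Q P := Bmap lb_proj lb_act.
End Lift.

Lemma pull_pr_subproof X X' (f : X' -> X) (P : prebundle R X) (p : pull f P) :
  prj P (fib2 p) = f (prj (pull f P) p).
Proof. by rewrite -fib_eq. Qed.
Definition pull_pr X X' (f : X' -> X) (P : prebundle R X) : bmap f (pull f P) P :=
  @Bmap _ _ f (pull f P) P (@fib2 _ _ _ _ _) (@pull_pr_subproof X X' f P)
    (fun _ _ => erefl).

Section PullMap.
Variables (A A' X X' : topologicalType) (d : A -> X) (d' : A' -> X').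
Variables (h : A -> A') (g : X -> X') (e : forall a, d' (h a) = g (d a)).
Variables (P : prebundle R X) (P' : prebundle R X') (F : bmap g P P').

Let pm_subproof (p : pull d P) : d' (h (fib1 p)) = prj P' (F (fib2 p)).
Proof. by rewrite e bmap_proj fib_eq. Qed.
Let pm (p : pull d P) : pull d' P' := fpair (pm_subproof p).
Let pm_proj p : prj (pull d' P') (pm p) = h (prj (pull d P) p).
Proof. by []. Qed.
Let pm_act u p : pm (uact u p) = uact u (pm p).
Proof. by apply: fibprod_inj => //; exact: bmap_act. Qed.
Definition bmap_pull : bmap h (pull d P) (pull d' P') := Bmap pm_proj pm_act.
End PullMap.

Section TensMap.
Variables (X X' : topologicalType) (g : X -> X').
Variables (P Q : prebundle R X) (P' Q' : prebundle R X').
Variables (F : bmap g P P') (G : bmap g Q Q').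

Lemma bmap_dual_act u (p : dual P) :
  F (@uact _ _ (dual P) u p) = @uact _ _ (dual P') u (F p).
Proof. exact: bmap_act. Qed.
Definition bmap_dual : bmap g (dual P) (dual P') :=
  @Bmap _ _ g (dual P) (dual P') F (bmap_proj F) bmap_dual_act.

Let tm_subproof p q : prj P p = prj Q q -> prj P' (F p) = prj Q' (G q).
Proof. by rewrite !bmap_proj => ->. Qed.
Let tm (t : tensor P Q) : tensor P' Q' :=
  tpure (tm_subproof (tens_fst_snd t)).
Let tm_proj t : prj (tensor P' Q') (tm t) = g (prj (tensor P Q) t).
Proof. by rewrite prj_tpure bmap_proj. Qed.

Lemma tens_tpure p q (e : prj P p = prj Q q) : exists u,
  tens_fst (tpure e) = uact u p /\ tens_snd (tpure e) = uact (u1_inv u) q.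
Proof.
have ep : prj P p = prj P (tens_fst (tpure e)).
  by rewrite prj_tens_fst prj_tpure.
have [u eu] := uact_trans ep; exists u; split=> //.
have eq : prj Q q = prj Q (tens_snd (tpure e)).
  by rewrite -tens_fst_snd -ep.
have [v ev] := uact_trans eq; rewrite ev.
have e' : prj P (uact (u1_mul u v) p) = prj Q q by rewrite prj_act.
have : uact (u1_mul u v) (tpure e : tensor P Q) = tpure e.
  rewrite (uact_tpure e e') -[RHS]tens_fstK; apply: (tpure_eq _ _ (u := u1_inv v)).
    by rewrite eu uactM u1_mulC -u1_mulA u1_mulV u1_mul1.
  by rewrite u1_invK.
move/uact_free => uv1; congr (uact _ _).
by rewrite -[v]u1_mul1 -(u1_mulV u) u1_mulA [u1_mul v u]u1_mulC uv1 u1_mulC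
  u1_mul1.
Qed.

Lemma bmap_tens_tpure p q (e : prj P p = prj Q q)
    (e' : prj P' (F p) = prj Q' (G q)) : tm (tpure e) = tpure e'.
Proof.
have [u [e1 e2]] := tens_tpure e; apply/esym/(tpure_eq _ _ (u := u)).
  by rewrite e1 bmap_act.
by rewrite e2 bmap_act.
Qed.

Let tm_act u t : tm (uact u t) = uact u (tm t).
Proof.
have [p [q [e ->]]] := tpureP t.
have eu : prj P (uact u p) = prj Q q by rewrite prj_act.
rewrite (uact_tpure e eu) (bmap_tens_tpure _ (tm_subproof eu)).
rewrite (bmap_tens_tpure _ (tm_subproof e)).
have eu' : prj P' (uact u (F p)) = prj Q' (G q).
  by rewrite prj_act; exact: tm_subproof.
rewrite (uact_tpure _ eu'); apply: (tpure_eq _ _ (u := u1_one)).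
  by rewrite uact1 bmap_act.
by rewrite u1_inv1 uact1.
Qed.
Definition bmap_tens : bmap g (tensor P Q) (tensor P' Q') := Bmap tm_proj tm_act.
End TensMap.

(** ** The operator [delta] *)

(** [d0^* E (x) d1^* E^* (x) d2^* E (x) ...] for a family of [k.+1] face maps;
    the sign [b] is that of the first factor. *)
Definition signed X (b : bool) (P : prebundle R X) := if b then P else dual P.

Fixpoint delta_from X' X (b : bool) (k : nat) :
    ('I_k.+1 -> X' -> X) -> prebundle R X -> prebundle R X' :=
  match k with
  | 0 => fun d E => signed b (pull (d ord0) E)
  | k'.+1 => fun d E => tensor (signed b (pull (d ord0) E))
               (delta_from (~~ b) (fun i : 'I_k'.+1 => d (lift ord0 i)) E)
  end.

Definition delta X' X k (d : 'I_k.+1 -> X' -> X) (E : prebundle R X) :=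
  delta_from true d E.

Definition signed_sec X b (P : prebundle R X) :
    section P -> section (signed b P) :=
  if b return section P -> section (signed b P) then id else @dual_sec X P.

Fixpoint delta_from_sec X' X b k :
    forall (d : 'I_k.+1 -> X' -> X) (E : prebundle R X),
      section E -> section (delta_from b d E) :=
  match k with
  | 0 => fun d E s => signed_sec b (pull_sec (d ord0) s)
  | k'.+1 => fun d E s => tens_sec (signed_sec b (pull_sec (d ord0) s))
       (delta_from_sec (~~ b) (fun i : 'I_k'.+1 => d (lift ord0 i)) s)
  end.

(** The section [delta(s)] induced by [s]. *)
Definition delta_sec X' X k (d : 'I_k.+1 -> X' -> X) (E : prebundle R X)
  (s : section E) : section (delta d E) := delta_from_sec true d s.

Definition bmap_signed X X' b (g : X -> X') (P : prebundle R X)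
    (P' : prebundle R X') : bmap g P P' -> bmap g (signed b P) (signed b P') :=
  if b return bmap g P P' -> bmap g (signed b P) (signed b P') then id
  else @bmap_dual X X' g P P'.

Fixpoint bmap_delta_from (A A' : topologicalType) X X' b k (h : A -> A') (g : X -> X') :
    forall (d : 'I_k.+1 -> A -> X) (d' : 'I_k.+1 -> A' -> X')
      (e : forall i a, d' i (h a) = g (d i a))
      (P : prebundle R X) (P' : prebundle R X'),
      bmap g P P' -> bmap h (delta_from b d P) (delta_from b d' P') :=
  match k with
  | 0 => fun d d' e P P' F => bmap_signed b (bmap_pull (e ord0) F)
  | k'.+1 => fun d d' e P P' F =>
      bmap_tens (bmap_signed b (bmap_pull (e ord0) F))
        (bmap_delta_from (~~ b) (fun i : 'I_k'.+1 => e (lift ord0 i)) F)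
  end.

(** The map [delta P -> delta P'] induced by a bundle map and a map of face
    maps. *)
Definition bmap_delta (A A' : topologicalType) X X' k (h : A -> A') (g : X -> X')
    (d : 'I_k.+1 -> A -> X) (d' : 'I_k.+1 -> A' -> X')
    (e : forall i a, d' i (h a) = g (d i a))
    (P : prebundle R X) (P' : prebundle R X') (F : bmap g P P') :
    bmap h (delta d P) (delta d' P') :=
  bmap_delta_from true e F.

Definition bmap_delta_id X' X k (d : 'I_k.+1 -> X' -> X) (P Q : prebundle R X)
    (F : bmap id P Q) : bmap id (delta d P) (delta d Q) :=
  bmap_delta (h := id) (g := id) (d := d) (d' := d) (fun _ _ => erefl) F.

(** [d_i d_j = d_(j-1) d_i] for [i < j]. *)
Definition simplicial_id A B C k (d : 'I_k.+1 -> B -> C)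
    (d' : 'I_k.+2 -> A -> B) : Prop :=
  forall (i j1 : 'I_k.+1) (i' j : 'I_k.+2),
    (i < j)%N -> i' = i :> nat -> j1 = j.-1 :> nat ->
    forall a, d i (d' j a) = d j1 (d' i' a).

(** Canonical sections and isomorphisms.  Each of them is the one that matches
    the elements obtained from one choice [e] of elements of [E] in all the
    fibres involved.  When the face maps satisfy the (bi-)simplicial identities,
    the same elements of [E] enter both sides with the same signs (with
    cancelling signs in the case of [delta_one]), and the result does not
    depend on [e]. *)

(** The canonical section [1] of [delta (delta E)]. *)
Definition delta_one X'' X' X l k (d' : 'I_l.+1 -> X'' -> X')
    (d : 'I_k.+1 -> X' -> X) (E : prebundle R X) : section (delta d' (delta d E)) :=
  delta_sec d' (delta_sec d (some_section E)).

(** [delta_v (delta_h E) -> delta_h (delta_v E)]. *)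
Definition delta_swap (X11 X10 X01 : topologicalType) X k l
    (v' : 'I_l.+1 -> X11 -> X10) (h : 'I_k.+1 -> X10 -> X)
    (h' : 'I_k.+1 -> X11 -> X01) (v : 'I_l.+1 -> X01 -> X) (E : prebundle R X) :
    bmap id (delta v' (delta h E)) (delta h' (delta v E)) :=
  bmap_of_sec (delta_sec v' (delta_sec h (some_section E)))
              (delta_sec h' (delta_sec v (some_section E))).

(** [delta E (x) delta F -> delta (E (x) F)]. *)
Definition delta_tens X' X k (d : 'I_k.+1 -> X' -> X) (E F : prebundle R X) :
    bmap id (tensor (delta d E) (delta d F)) (delta d (tensor E F)) :=
  bmap_of_sec
    (tens_sec (delta_sec d (some_section E)) (delta_sec d (some_section F)))
    (delta_sec d (tens_sec (some_section E) (some_section F))).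

(** Independence of the choice of [e]. *)

Lemma bmap_of_secE X (P Q : prebundle R X) (s : section P) (t : section Q) x :
  bmap_of_sec s t (s x) = t x.
Proof.
rewrite /bmap_of_sec /=; set r := uratio _.
have -> : r = u1_one.
  apply: (@uact_regular _ P _ _ (s (prj P (s x)))).
  by rewrite /r -uratioP uact1 secK.
by rewrite uact1 secK.
Qed.

Lemma section_ratio X (P : prebundle R X) (s s' : section P) :
  exists u : X -> U1 R, forall x, s' x = uact (u x) (s x).
Proof.
have h x : {u | s' x = uact u (s x)} by apply/cid/uact_trans; rewrite !secK.
by exists (fun x => sval (h x)) => x; exact: (svalP (h x)).
Qed.

Definition u1_signed (b : bool) (u : U1 R) : U1 R := if b then u else u1_inv u.

Fixpoint delta_fun X' X (b : bool) (k : nat) :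
    ('I_k.+1 -> X' -> X) -> (X -> U1 R) -> X' -> U1 R :=
  match k with
  | 0 => fun d u z => u1_signed b (u (d ord0 z))
  | k'.+1 => fun d u z => u1_mul (u1_signed b (u (d ord0 z)))
       (delta_fun (~~ b) (fun i : 'I_k'.+1 => d (lift ord0 i)) u z)
  end.

Lemma signed_sec_act X' X b (f : X' -> X) (P : prebundle R X) u
    (s s' : section P) z : s' (f z) = uact u (s (f z)) ->
  signed_sec b (pull_sec f s') z =
  uact (u1_signed b u) (signed_sec b (pull_sec f s) z).
Proof.
by case: b => e; apply: fibprod_inj => //=; rewrite [LHS]e // u1_invK.
Qed.

Lemma tens_sec_act X (P Q : prebundle R X) u v (s s' : section P)
    (t t' : section Q) z : s' z = uact u (s z) -> t' z = uact v (t z) ->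
  tens_sec s' t' z = uact (u1_mul u v) (tens_sec s t z).
Proof.
move=> es et.
have e : prj P (uact (u1_mul u v) (s z)) = prj Q (t z).
  by rewrite prj_act !secK.
apply/esym/(etrans (uact_tpure (tens_sec_subproof s t z) e)).
apply: (tpure_eq _ _ (u := u1_inv v)); last by rewrite u1_invK.
by rewrite es uactM u1_mulC -u1_mulA u1_mulV u1_mul1.
Qed.

Lemma delta_from_sec_act X' X b k (d : 'I_k.+1 -> X' -> X) (P : prebundle R X)
    (u : X -> U1 R) (s s' : section P) :
  (forall x, s' x = uact (u x) (s x)) -> forall z,
  delta_from_sec b d s' z = uact (delta_fun b d u z) (delta_from_sec b d s z).
Proof.
move=> e; elim: k b d => [|k IH] b d z /=; first exact: signed_sec_act.
by apply: tens_sec_act; [exact: signed_sec_act | exact: IH].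
Qed.

Lemma delta_sec_act X' X k (d : 'I_k.+1 -> X' -> X) (P : prebundle R X)
    (u : X -> U1 R) (s s' : section P) :
  (forall x, s' x = uact (u x) (s x)) -> forall z,
  delta_sec d s' z = uact (delta_fun true d u z) (delta_sec d s z).
Proof. exact: delta_from_sec_act. Qed.

Let sgv (b : bool) (x : R[i]) : R[i] := if b then x else x^-1.

Let sgvM b x y : sgv b (x * y) = sgv b x * sgv b y.
Proof. by case: b => //=; rewrite invfM. Qed.
Let sgv_prod b (I : finType) (F : I -> R[i]) :
  sgv b (\prod_i F i) = \prod_i sgv b (F i).
Proof.
by apply: (big_morph (sgv b) (sgvM b)); case: b => //=; rewrite invr1.
Qed.

Lemma u1_val_delta_fun X' X b k (d : 'I_k.+1 -> X' -> X) u z :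
  u1_val (delta_fun b d u z) =
  \prod_(i < k.+1) (if b (+) odd i then u1_val (u (d i z))
                    else (u1_val (u (d i z)))^-1).
Proof.
elim: k b d => [|k IH] b d /=; first by rewrite big_ord1 addbF; case: b.
rewrite big_ord_recl /= addbF; congr (_ * _); first by case: b.
rewrite IH; apply: eq_bigr => i _.
by rewrite addNb -addbN.
Qed.

Lemma delta_fun_one X'' X' X k (d' : 'I_k.+2 -> X'' -> X')
    (d : 'I_k.+1 -> X' -> X) (u : X -> U1 R) z : simplicial_id d d' ->
  delta_fun true d' (delta_fun true d u) z = u1_one.
Proof.
move=> dd'; apply: u1_inj; rewrite u1_val_delta_fun.
pose f (p : 'I_k.+2 * 'I_k.+1) : R[i] := u1_val (u (d p.2 (d' p.1 z))).
pose F (p : 'I_k.+2 * 'I_k.+1) : R[i] := sgv (~~ odd (p.1 + p.2)) (f p).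
transitivity (\prod_p F p).
  rewrite -(pair_bigA _ (fun i j => F (i, j))) /=; apply: eq_bigr => i _.
  rewrite -/(sgv _ _) u1_val_delta_fun sgv_prod; apply: eq_bigr => j _.
  by rewrite /F /sgv /= oddD; case: (odd i); case: (odd j) => //=; rewrite invrK.
rewrite (bigID (fun p : 'I_k.+2 * 'I_k.+1 => (p.1 <= p.2)%N)) /=.
pose h (p : 'I_k.+2 * 'I_k.+1) : 'I_k.+2 * 'I_k.+1 := (lift ord0 p.2, inord p.1).
pose h' (p : 'I_k.+2 * 'I_k.+1) : 'I_k.+2 * 'I_k.+1 :=
  (widen_ord (leqnSn _) p.2, inord p.1.-1).
rewrite [X in _ * X](reindex_onto h h') /=; last first.
  move=> [i j] /=; rewrite -ltnNge => ji; congr pair; apply: val_inj => /=.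
    rewrite /bump leq0n add1n inordK; first by rewrite prednK// (leq_ltn_trans _ ji).
    by case: i ji => -[|i].
  by rewrite inordK // ltnS -ltnS ltn_ord.
rewrite [X in _ * X](eq_bigl (fun p : 'I_k.+2 * 'I_k.+1 => (p.1 <= p.2)%N)); last first.
  move=> [i j] /=; rewrite /h /h' /= /bump leq0n add1n -ltnNge ltnS.
  have [ik|ki] := ltnP i k.+1.
    set c := (_ == _); have -> : c.
      apply/eqP; congr pair; apply: val_inj; first by rewrite /= inordK.
      by rewrite /= add0n inordK.
    by rewrite andbT inordK.
  have -> : (i <= j)%N = false by apply/negbTE; rewrite -ltnNge (leq_trans _ ki).
  apply/negbTE; rewrite negb_and; apply/orP; right; apply/eqP => -[/(congr1 val)] /=.
  by move=> e; move: (ltn_ord (inord i : 'I_k.+1)); rewrite e ltnNge ki.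
rewrite -big_split big1 // => -[i j] /= ij.
have -> : F (h (i, j)) = (F (i, j))^-1.
  have hi : (i < k.+1)%N by rewrite (leq_ltn_trans ij).
  have fh : f (h (i, j)) = f (i, j).
    by rewrite /f /h /= (dd' (inord i) j i (lift ord0 j)) //= inordK.
  have oh : odd ((h (i, j)).1 + (h (i, j)).2) = ~~ odd (i + j).
    have -> : ((h (i, j)).1 + (h (i, j)).2 = (i + j).+1)%N.
      by rewrite /h /= (inordK hi) addnC -addnS.
    by [].
  by rewrite /F fh oh /sgv /=; case: odd => //=; rewrite invrK.
by rewrite divff// /F /sgv; case: ifP; rewrite ?invr_eq0 u1_neq0.
Qed.

Lemma delta_oneE X'' X' X k (d' : 'I_k.+2 -> X'' -> X') (d : 'I_k.+1 -> X' -> X)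
    (E : prebundle R X) (e : section E) : simplicial_id d d' ->
  delta_sec d' (delta_sec d e) =1 delta_one d' d E.
Proof.
move=> dd' z; have [u eu] := section_ratio (some_section E) e.
rewrite (delta_sec_act d' (delta_sec_act d eu)) (delta_fun_one _ _ dd').
by rewrite uact1.
Qed.

Lemma delta_swapE (X11 X10 X01 : topologicalType) X k l
    (v' : 'I_l.+1 -> X11 -> X10) (h : 'I_k.+1 -> X10 -> X)
    (h' : 'I_k.+1 -> X11 -> X01) (v : 'I_l.+1 -> X01 -> X) (E : prebundle R X)
    (e : section E) z :
  (forall i j z, h i (v' j z) = v j (h' i z)) ->
  delta_swap v' h h' v E (delta_sec v' (delta_sec h e) z) =
  delta_sec h' (delta_sec v e) z.
Proof.
move=> hv; have [u eu] := section_ratio (some_section E) e.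
rewrite (delta_sec_act v' (delta_sec_act h eu)).
rewrite (delta_sec_act h' (delta_sec_act v eu)) bmap_act bmap_of_secE.
congr (uact _ _); apply: u1_inj; rewrite !u1_val_delta_fun.
under eq_bigr => j _ do rewrite -/(sgv _ _) u1_val_delta_fun sgv_prod.
under [RHS]eq_bigr => i _ do rewrite -/(sgv _ _) u1_val_delta_fun sgv_prod.
rewrite exchange_big; apply: eq_bigr => i _; apply: eq_bigr => j _ /=.
by rewrite hv /sgv; do 2!case: odd.
Qed.

Lemma delta_tensE X' X k (d : 'I_k.+1 -> X' -> X) (E F : prebundle R X)
    (e : section E) (f : section F) z :
  delta_tens d E F (tens_sec (delta_sec d e) (delta_sec d f) z) =
  delta_sec d (tens_sec e f) z.
Proof.
have [u eu] := section_ratio (some_section E) e.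
have [v ev] := section_ratio (some_section F) f.
have euv x : tens_sec e f x = uact (u1_mul (u x) (v x))
    (tens_sec (some_section E) (some_section F) x) by exact: tens_sec_act.
rewrite (tens_sec_act (delta_sec_act d eu z) (delta_sec_act d ev z)).
rewrite (delta_sec_act d euv) bmap_act bmap_of_secE; congr (uact _ _).
apply: u1_inj; rewrite u1_val_delta_fun /= -[LHS]/(u1_val _ * u1_val _).
rewrite !u1_val_delta_fun -big_split; apply: eq_bigr => i _ /=.
by case: odd => //=; rewrite -invfM.
Qed.
End Bundles.

(** * Bundle gerbes *)

Definition bundle_gerbe (R : realType) (Y X : topologicalType) (f : Y -> X)
    (E : prebundle R (fibpow f 2))
    (m : section (delta (@fpface Y X f 2) E)) : Prop :=
  [/\ is_cover f, principal E, continuous m &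
      delta_sec (@fpface Y X f 3) m =1
        delta_one (@fpface Y X f 3) (@fpface Y X f 2) E].

(** * 3-truncated semisimplicial spaces over [Y^[n+1]] *)

Record sspace := SSpace {
  ss0 : topologicalType;
  ss1 : topologicalType;
  ss2 : topologicalType;
  ss3 : topologicalType;
  sd1 : 'I_2 -> ss1 -> ss0;
  sd2 : 'I_3 -> ss2 -> ss1;
  sd3 : 'I_4 -> ss3 -> ss2 }.

Arguments sd1 : clear implicits.
Arguments sd2 : clear implicits.
Arguments sd3 : clear implicits.

Lemma fpface_id (A B : topologicalType) (f : A -> B) (k : nat) :
  simplicial_id (@fpface _ _ f k) (@fpface _ _ f k.+1).
Proof.
move=> i j1 i' j ij ei ej a; apply: fibpow_inj => l.
congr (set_val a _); apply: val_inj => /=.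
rewrite ej ei /bump; move: ij; case: j ej => [[//|j] /= hj] _.
rewrite ltnS => ij.
case: (leqP i l) => il; case: (leqP j l) => jl /=;
  rewrite ?add0n ?add1n ?ltnS; move: il jl ij => /=; lia.
Qed.

Definition simplicial (S : sspace) : Prop :=
  simplicial_id (sd1 S) (sd2 S) /\ simplicial_id (sd2 S) (sd3 S).

(** A map [S -> Y^[n+1]] commuting with the faces, where [Y^[1]] is [Y]. *)
Record ss_over (Y X : topologicalType) (y : Y -> X) := SSOver {
  ss_base :> sspace;
  pi0 : ss0 ss_base -> Y;
  pi1 : ss1 ss_base -> fibpow y 2;
  pi2 : ss2 ss_base -> fibpow y 3;
  pi3 : ss3 ss_base -> fibpow y 4;
  pi_sd1 : forall i z, pi0 (sd1 _ i z) = fpface1 i (pi1 z);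
  pi_sd2 : forall i z, pi1 (sd2 _ i z) = fpface i (pi2 z);
  pi_sd3 : forall i z, pi2 (sd3 _ i z) = fpface i (pi3 z) }.

Arguments pi0 {Y X y} s _.
Arguments pi1 {Y X y} s _.
Arguments pi2 {Y X y} s _.
Arguments pi3 {Y X y} s _.

Record is_ss_cover (Y X : topologicalType) (y : Y -> X) (S : ss_over y) :
    Prop := {
  ss_simplicial : simplicial S;
  sd1_continuous : forall i, continuous (sd1 S i);
  sd2_continuous : forall i, continuous (sd2 S i);
  sd3_continuous : forall i, continuous (sd3 S i);
  pi0_cover : is_cover (pi0 S);
  pi1_cover : is_cover (pi1 S);
  pi2_cover : is_cover (pi2 S);
  pi3_cover : is_cover (pi3 S) }.


Section Faces.
Variables (Y X : topologicalType) (y : Y -> X) (S : ss_over y).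

(** Horizontal faces [S_n^[k] -> S_(n-1)^[k]]. *)
Definition hface1 k (i : 'I_2) : fibpow (pi1 S) k -> fibpow (pi0 S) k :=
  @fpmap _ _ _ _ (pi1 S) (pi0 S) (sd1 S i) (fpface1 i) (pi_sd1 (s := S) i) k.
Definition hface2 k (i : 'I_3) : fibpow (pi2 S) k -> fibpow (pi1 S) k :=
  @fpmap _ _ _ _ (pi2 S) (pi1 S) (sd2 S i) (fpface i) (pi_sd2 (s := S) i) k.
Definition hface3 k (i : 'I_4) : fibpow (pi3 S) k -> fibpow (pi2 S) k :=
  @fpmap _ _ _ _ (pi3 S) (pi2 S) (sd3 S i) (fpface i) (pi_sd3 (s := S) i) k.

(** Vertical faces [S_n^[k+1] -> S_n^[k]]; for [k = 1] the target is [S_n]. *)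
Definition vface0 k (i : 'I_k.+1) : fibpow (pi0 S) k.+1 -> fibpow (pi0 S) k :=
  fpface i.
Definition vface1 k (i : 'I_k.+1) : fibpow (pi1 S) k.+1 -> fibpow (pi1 S) k :=
  fpface i.
Definition vface2 k (i : 'I_k.+1) : fibpow (pi2 S) k.+1 -> fibpow (pi2 S) k :=
  fpface i.
Definition vface1_base (i : 'I_2) : fibpow (pi1 S) 2 -> ss1 S := fpface1 i.
Definition vface2_base (i : 'I_2) : fibpow (pi2 S) 2 -> ss2 S := fpface1 i.
End Faces.

(** * Rigid bundle 2-gerbes

    Here and for bigerbes, a record of spaces, maps, bundles and sections comes
    with a predicate [is_...] that collects the continuity conditions and the
    equations.  Equations between sections of different iterated [delta]'s are
    stated along the canonical isomorphisms [delta_swap] and [delta_tens]. *)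

Section Rigid.
Context {R : realType} {Y X : topologicalType} {y : Y -> X}.

Record rigid2gerbe := Rigid2Gerbe {
  rZ : ss_over y;
  rE : prebundle R (fibpow (pi1 rZ) 2);
  rm : section (delta (@vface1 _ _ _ rZ 2) rE);
  rM : section (delta (@hface2 _ _ _ rZ 2) rE) }.

Record is_rigid2gerbe (G : rigid2gerbe) : Prop := {
  rigid_cover : is_cover y;
  rigid_ss_cover : is_ss_cover (rZ G);
  rigid_gerbe : bundle_gerbe (f := pi1 (rZ G)) (rm G);
  rigid_M_continuous : continuous (rM G);
  rigid_Mm : forall z : fibpow (pi2 (rZ G)) 3,
    delta_swap (@vface2 _ _ _ (rZ G) 2) (@hface2 _ _ _ (rZ G) 2)
               (@hface2 _ _ _ (rZ G) 3) (@vface1 _ _ _ (rZ G) 2) (rE G)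
      (delta_sec (@vface2 _ _ _ (rZ G) 2) (rM G) z) =
    delta_sec (@hface2 _ _ _ (rZ G) 3) (rm G) z;
  rigid_MM : delta_sec (@hface3 _ _ _ (rZ G) 2) (rM G) =1
    delta_one (@hface3 _ _ _ (rZ G) 2) (@hface2 _ _ _ (rZ G) 2) (rE G) }.

Record rigid_triv (G : rigid2gerbe) := RigidTriv {
  rtF : prebundle R (fibpow (pi0 (rZ G)) 2);
  rtm : section (delta (@vface0 _ _ _ (rZ G) 2) rtF);
  rt_iso : bmap id (rE G) (delta (@hface1 _ _ _ (rZ G) 2) rtF) }.

Record is_rigid_triv (G : rigid2gerbe) (T : rigid_triv G) : Prop := {
  rigid_triv_gerbe : bundle_gerbe (f := pi0 (rZ G)) (rtm T);
  rigid_triv_iso : bundle_iso (rt_iso T);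
  rigid_triv_m : forall z : fibpow (pi1 (rZ G)) 3,
    delta_swap (@vface1 _ _ _ (rZ G) 2) (@hface1 _ _ _ (rZ G) 2)
               (@hface1 _ _ _ (rZ G) 3) (@vface0 _ _ _ (rZ G) 2) (rtF T)
      (bmap_delta_id (@vface1 _ _ _ (rZ G) 2) (rt_iso T) (rm G z)) =
    delta_sec (@hface1 _ _ _ (rZ G) 3) (rtm T) z;
  rigid_triv_M : forall z : fibpow (pi2 (rZ G)) 2,
    bmap_delta_id (@hface2 _ _ _ (rZ G) 2) (rt_iso T) (rM G z) =
    delta_one (@hface2 _ _ _ (rZ G) 2) (@hface1 _ _ _ (rZ G) 2) (rtF T) z }.

(** ** Morphisms over the identity of [Y^[n+1]] *)

Record ss_map (S' S : ss_over y) := SSMap {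
  sm0 : ss0 S' -> ss0 S;
  sm1 : ss1 S' -> ss1 S;
  sm2 : ss2 S' -> ss2 S;
  sm3 : ss3 S' -> ss3 S;
  sm_pi0 : forall z, pi0 S (sm0 z) = id (pi0 S' z);
  sm_pi1 : forall z, pi1 S (sm1 z) = id (pi1 S' z);
  sm_pi2 : forall z, pi2 S (sm2 z) = id (pi2 S' z);
  sm_pi3 : forall z, pi3 S (sm3 z) = id (pi3 S' z);
  sm_sd1 : forall i z, sd1 S i (sm1 z) = sm0 (sd1 S' i z);
  sm_sd2 : forall i z, sd2 S i (sm2 z) = sm1 (sd2 S' i z);
  sm_sd3 : forall i z, sd3 S i (sm3 z) = sm2 (sd3 S' i z) }.

Section SSMap.
Variables (S' S : ss_over y) (f : ss_map S' S).

Definition smpow0 k : fibpow (pi0 S') k -> fibpow (pi0 S) k :=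
  @fpmap _ _ _ _ (pi0 S') (pi0 S) (sm0 f) id (sm_pi0 f) k.
Definition smpow1 k : fibpow (pi1 S') k -> fibpow (pi1 S) k :=
  @fpmap _ _ _ _ (pi1 S') (pi1 S) (sm1 f) id (sm_pi1 f) k.
Definition smpow2 k : fibpow (pi2 S') k -> fibpow (pi2 S) k :=
  @fpmap _ _ _ _ (pi2 S') (pi2 S) (sm2 f) id (sm_pi2 f) k.

Lemma smpow1_vface k (i : 'I_k.+1) a :
  vface1 i (smpow1 a) = smpow1 (vface1 i a).
Proof. exact: fibpow_inj. Qed.
Lemma smpow1_hface k i a : hface1 i (smpow1 a) = smpow0 (k := k) (hface1 i a).
Proof. by apply: fibpow_inj => j; exact: sm_sd1. Qed.
Lemma smpow2_hface k i a : hface2 i (smpow2 a) = smpow1 (k := k) (hface2 i a).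
Proof. by apply: fibpow_inj => j; exact: sm_sd2. Qed.
End SSMap.

Record rigid_mor (G' G : rigid2gerbe) := RigidMor {
  mor_ss : ss_map (rZ G') (rZ G);
  mor_E : bmap (@smpow1 _ _ mor_ss 2) (rE G') (rE G) }.

Record is_rigid_mor (G' G : rigid2gerbe) (f : rigid_mor G' G) : Prop := {
  mor0_continuous : continuous (sm0 (mor_ss f));
  mor1_continuous : continuous (sm1 (mor_ss f));
  mor2_continuous : continuous (sm2 (mor_ss f));
  mor3_continuous : continuous (sm3 (mor_ss f));
  morE_continuous : continuous (mor_E f);
  mor_m : forall z : fibpow (pi1 (rZ G')) 3,
    bmap_delta (@smpow1_vface _ _ (mor_ss f) 2) (mor_E f) (rm G' z) =
    rm G (smpow1 (mor_ss f) z);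
  mor_M : forall z : fibpow (pi2 (rZ G')) 2,
    bmap_delta (@smpow2_hface _ _ (mor_ss f) 2) (mor_E f) (rM G' z) =
    rM G (smpow2 (mor_ss f) z) }.

(** The pullback of [E, m, M] along a semisimplicial map, and its morphism to
    the original data. *)
Section PullGerbe.
Variables (G : rigid2gerbe) (S' : ss_over y) (f : ss_map S' (rZ G)).
Let E' := pull (@smpow1 _ _ f 2) (rE G).
Let prE : bmap (@smpow1 _ _ f 2) E' (rE G) := pull_pr (@smpow1 _ _ f 2) (rE G).

Definition pull_gerbe : rigid2gerbe :=
  @Rigid2Gerbe S' E'
    (lift_sec (bmap_delta (@smpow1_vface _ _ f 2) prE) (rm G))
    (lift_sec (bmap_delta (@smpow2_hface _ _ f 2) prE) (rM G)).

Definition pull_gerbe_mor : rigid_mor pull_gerbe G :=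
  @RigidMor pull_gerbe G f prE.
End PullGerbe.
End Rigid.

Arguments rigid2gerbe R {Y X} y.

(** * Bigerbes *)

Record bisquare (X : topologicalType) := BiSquare {
  bW : topologicalType;
  bY1 : topologicalType;
  bY2 : topologicalType;
  bw1 : bW -> bY1;
  bw2 : bW -> bY2;
  by1 : bY1 -> X;
  by2 : bY2 -> X;
  b_comm : forall w, by1 (bw1 w) = by2 (bw2 w) }.

Section BiSquare.
Variables (X : topologicalType) (Q : bisquare X).

Definition bW12 (w : bW Q) : fibprod (@by1 X Q) (@by2 X Q) := fpair (b_comm w).

(** [W^[n+1,1] -> Y_1^[n+1]]. *)
Definition bsq_sspace : sspace :=
  @SSpace (bW Q) (fibpow (@bw2 X Q) 2) (fibpow (@bw2 X Q) 3)
    (fibpow (@bw2 X Q) 4) (@fpface1 _ _ _) (@fpface _ _ _ 2) (@fpface _ _ _ 3).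

Definition bsq_pi k : fibpow (@bw2 X Q) k -> fibpow (@by1 X Q) k :=
  @fpmap _ _ _ _ (@bw2 X Q) (@by1 X Q) (@bw1 X Q) (@by2 X Q) (@b_comm X Q) k.

Lemma bsq_pi_face k i a :
  bsq_pi (fpface i a : fibpow (@bw2 X Q) k) = fpface i (bsq_pi a).
Proof. exact: fibpow_inj. Qed.

Definition bsq_over : ss_over (@by1 X Q) :=
  @SSOver _ _ _ bsq_sspace (@bw1 X Q) (@bsq_pi 2) (@bsq_pi 3) (@bsq_pi 4)
    (fun _ _ => erefl) (@bsq_pi_face 2) (@bsq_pi_face 3).

Lemma bsq_simplicial : simplicial bsq_over.
Proof.
split; last exact: fpface_id.
move=> i j1 i' j ij ei ej a; apply: (congr1 (fun b => fpev b ord0)).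
exact: (@fpface_id _ _ _ 1).
Qed.
End BiSquare.

Section Bigerbe.
Context {R : realType} {X : topologicalType}.

Record bigerbe := Bigerbe {
  bsq :> bisquare X;
  bE : prebundle R (fibpow (pi1 (bsq_over bsq)) 2);
  bM : section (delta (@hface2 _ _ _ (bsq_over bsq) 2) bE);
  bs : section (delta (@vface1 _ _ _ (bsq_over bsq) 2) bE) }.

Record is_bigerbe (B : bigerbe) : Prop := {
  bw1_cover : is_cover (@bw1 X B);
  bw2_cover : is_cover (@bw2 X B);
  by1_cover : is_cover (@by1 X B);
  by2_cover : is_cover (@by2 X B);
  bW12_cover : is_cover (@bW12 X B);
  bE_principal : principal (bE B);
  bM_continuous : continuous (bM B);
  bs_continuous : continuous (bs B);
  b_MM : delta_sec (@hface3 _ _ _ (bsq_over B) 2) (bM B) =1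
    delta_one (@hface3 _ _ _ (bsq_over B) 2) (@hface2 _ _ _ (bsq_over B) 2)
      (bE B);
  b_ss : delta_sec (@vface1 _ _ _ (bsq_over B) 3) (bs B) =1
    delta_one (@vface1 _ _ _ (bsq_over B) 3) (@vface1 _ _ _ (bsq_over B) 2)
      (bE B);
  b_Ms : forall z : fibpow (pi2 (bsq_over B)) 3,
    delta_swap (@vface2 _ _ _ (bsq_over B) 2) (@hface2 _ _ _ (bsq_over B) 2)
               (@hface2 _ _ _ (bsq_over B) 3) (@vface1 _ _ _ (bsq_over B) 2)
               (bE B)
      (delta_sec (@vface2 _ _ _ (bsq_over B) 2) (bM B) z) =
    delta_sec (@hface2 _ _ _ (bsq_over B) 3) (bs B) z }.

Record bitriv (B : bigerbe) := BiTriv {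
  bQ1 : prebundle R (fibpow (pi0 (bsq_over B)) 2);
  bt1 : section (delta (@vface0 _ _ _ (bsq_over B) 2) bQ1);
  bQ2 : prebundle R (ss1 (bsq_over B));
  bt2 : section (delta (sd2 (bsq_over B)) bQ2);
  bphi : bmap id (tensor (bE B) (delta (@vface1_base _ _ _ (bsq_over B)) bQ2))
                 (delta (@hface1 _ _ _ (bsq_over B) 2) bQ1) }.

Record is_bitriv (B : bigerbe) (t : bitriv B) : Prop := {
  bQ1_principal : principal (bQ1 t);
  bt1_continuous : continuous (bt1 t);
  bt1_one : delta_sec (@vface0 _ _ _ (bsq_over B) 3) (bt1 t) =1
    delta_one (@vface0 _ _ _ (bsq_over B) 3) (@vface0 _ _ _ (bsq_over B) 2)
      (bQ1 t);
  bQ2_principal : principal (bQ2 t);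
  bt2_continuous : continuous (bt2 t);
  bt2_one : delta_sec (sd3 (bsq_over B)) (bt2 t) =1
    delta_one (sd3 (bsq_over B)) (sd2 (bsq_over B)) (bQ2 t);
  bphi_iso : bundle_iso (bphi t);
  (* [M (x) delta_v t_2] corresponds to the canonical section of
     [delta_h^2 Q_1] *)
  bphi_M : forall z : fibpow (pi2 (bsq_over B)) 2,
    bmap_delta_id (@hface2 _ _ _ (bsq_over B) 2) (bphi t)
      (delta_tens _ _ _
        (tens_sec (bM B)
          (bmap_sec
            (delta_swap (@vface2_base _ _ _ (bsq_over B)) (sd2 (bsq_over B))
                        (@hface2 _ _ _ (bsq_over B) 2)
                        (@vface1_base _ _ _ (bsq_over B)) (bQ2 t))
            (delta_sec (@vface2_base _ _ _ (bsq_over B)) (bt2 t))) z)) =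
    delta_one (@hface2 _ _ _ (bsq_over B) 2) (@hface1 _ _ _ (bsq_over B) 2)
      (bQ1 t) z;
  (* [s (x) 1], for the canonical section [1] of [delta_v^2 Q_2], corresponds
     to [delta_h t_1] *)
  bphi_s : forall z : fibpow (pi1 (bsq_over B)) 3,
    delta_swap (@vface1 _ _ _ (bsq_over B) 2) (@hface1 _ _ _ (bsq_over B) 2)
               (@hface1 _ _ _ (bsq_over B) 3) (@vface0 _ _ _ (bsq_over B) 2)
               (bQ1 t)
      (bmap_delta_id (@vface1 _ _ _ (bsq_over B) 2) (bphi t)
        (delta_tens _ _ _
          (tens_sec (bs B)
            (delta_one (@vface1 _ _ _ (bsq_over B) 2)
                       (@vface1_base _ _ _ (bsq_over B)) (bQ2 t)) z))) =
    delta_sec (@hface1 _ _ _ (bsq_over B) 3) (bt1 t) z }.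

Definition r1 (B : bigerbe) : rigid2gerbe R (@by1 X B) :=
  @Rigid2Gerbe _ _ _ _ (bsq_over B) (bE B) (bs B) (bM B).
End Bigerbe.

Arguments bigerbe R X : clear implicits.

(** * The semisimplicial space [N(L)] *)

Section TensorComplete.
Context {R : realType} {X : topologicalType}.
Variables P Q : prebundle R X.

Lemma tens_complete_r (p : P) (t : tensor P Q) :
  prj P p = prj (tensor P Q) t ->
  exists q (e : prj P p = prj Q q), t = tpure e.
Proof.
have [p' [q' [e' ->]]] := tpureP t; rewrite prj_tpure => /uact_trans[u eu].
have e : prj P p = prj Q (uact u q') by rewrite prj_act -e' eu prj_act.
exists (uact u q'), e; apply: (tpure_eq _ _ (u := u1_inv u)).
  by rewrite eu uactM u1_mulC u1_mulV uact1.
by rewrite u1_invK.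
Qed.

Lemma tens_complete_l (q : Q) (t : tensor P Q) :
  prj Q q = prj (tensor P Q) t ->
  exists p (e : prj P p = prj Q q), t = tpure e.
Proof.
have [p' [q' [e' ->]]] := tpureP t; rewrite prj_tpure e' => /esym/uact_trans[u eu].
have e : prj P (uact (u1_inv u) p') = prj Q q by rewrite prj_act e' eu prj_act.
exists (uact (u1_inv u) p'), e.
by apply: (tpure_eq _ _ (u := u1_inv u)) => //; rewrite u1_invK.
Qed.
End TensorComplete.

Section Nerve.
Context {R : realType} {Y X : topologicalType} {y : Y -> X}.
Variables (S : ss_over y) (hS : simplicial S).
Variables (L : prebundle R (ss1 S)) (s : section (delta (sd2 S) L)).

Let o1 n : 'I_n.+2 := lift ord0 ord0.
Let o2 n : 'I_n.+3 := lift ord0 (lift ord0 ord0).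
Let o3 n : 'I_n.+4 := lift ord0 (lift ord0 (lift ord0 ord0)).

(** [d_0^* L x_(S_2) d_2^* L]. *)
Definition nerve2 : topologicalType :=
  fibprod (prj (pull (sd2 S ord0) L)) (prj (pull (sd2 S (o2 0)) L)).
Definition nerve2_base (x : nerve2) : ss2 S := fib1 (fib1 x).

Definition nerve2_pt (z : ss2 S) (l l' : L) (e : sd2 S ord0 z = prj L l)
    (e' : sd2 S (o2 0) z = prj L l') : nerve2 :=
  @fpair _ _ _ (prj (pull (sd2 S ord0) L)) (prj (pull (sd2 S (o2 0)) L))
    (fpair e) (fpair e') erefl.

(** The multiplication [d_0^* L (x) d_2^* L -> d_1^* L], evaluated on [x]: the
    element [c] with [fib1 x (x) c^* (x) fib2 x = s]. *)
Lemma nerve_mul_subproof1 (x : nerve2) (c : L)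
    (e : sd2 S (o1 1) (nerve2_base x) = prj L c) :
  prj (dual (pull (sd2 S (o1 1)) L)) (fpair e) =
  prj (pull (sd2 S (o2 0)) L) (fib2 x).
Proof. exact: (fib_eq x). Qed.
Lemma nerve_mul_subproof2 (x : nerve2) (c : L)
    (e : sd2 S (o1 1) (nerve2_base x) = prj L c) :
  prj (pull (sd2 S ord0) L) (fib1 x) =
  prj (tensor (dual (pull (sd2 S (o1 1)) L)) (pull (sd2 S (o2 0)) L))
    (tpure (nerve_mul_subproof1 e)).
Proof. by rewrite prj_tpure. Qed.

Lemma nerve_mul_subproof (x : nerve2) :
  {c : L | exists e : sd2 S (o1 1) (nerve2_base x) = prj L c,
     s (nerve2_base x) = tpure (nerve_mul_subproof2 e)}.
Proof.
apply: cid; set z := nerve2_base x.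
have pz : prj (pull (sd2 S ord0) L) (fib1 x) = prj (delta (sd2 S) L) (s z).
  by rewrite secK.
have [v [ev sv]] := tens_complete_r pz.
have vz : prj (pull (sd2 S (o2 0)) L) (fib2 x) =
    prj (tensor (dual (pull (sd2 S (o1 1)) L)) (pull (sd2 S (o2 0)) L)) v.
  by rewrite -(fib_eq x); exact: ev.
have [c' [ec vc]] := tens_complete_l vz.
have c'z : fib1 (c' : pull (sd2 S (o1 1)) L) = z.
  by apply: (etrans ec); rewrite -(fib_eq x).
have e : sd2 S (o1 1) z = prj L (fib2 (c' : pull (sd2 S (o1 1)) L)).
  by rewrite -(fib_eq (c' : pull (sd2 S (o1 1)) L)) c'z.
exists (fib2 (c' : pull (sd2 S (o1 1)) L)), e; rewrite sv.
have vE : v = tpure (nerve_mul_subproof1 e).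
  rewrite vc; apply: (tpure_eq _ _ (u := u1_one)).
    by rewrite uact1; apply: fibprod_inj => //=; exact/esym.
  by rewrite u1_inv1 uact1.
apply: (tpure_eq _ _ (u := u1_one)); first by rewrite uact1.
by rewrite u1_inv1 uact1 vE.
Qed.
Definition nerve_mul (x : nerve2) : L := sval (nerve_mul_subproof x).
Lemma nerve_mul_proj x : sd2 S (o1 1) (nerve2_base x) = prj L (nerve_mul x).
Proof. by have [] := svalP (nerve_mul_subproof x). Qed.

(** The edges [01], [12], [23] of a 3-simplex, and [N(L)_3]. *)
Definition edge01 (z : ss3 S) : ss1 S := sd2 S (o2 0) (sd3 S (o3 0) z).
Definition edge12 (z : ss3 S) : ss1 S := sd2 S ord0 (sd3 S (o3 0) z).
Definition edge23 (z : ss3 S) : ss1 S := sd2 S ord0 (sd3 S ord0 z).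

Definition nerve3 : topologicalType :=
  fibprod (prj (pull edge23 L))
    (fun ba : fibprod (prj (pull edge12 L)) (prj (pull edge01 L)) =>
       prj (pull edge12 L) (fib1 ba)).
Definition nerve3_base (x : nerve3) : ss3 S := fib1 (fib1 x).
Definition nerve3_23 (x : nerve3) : L := fib2 (fib1 x).
Definition nerve3_12 (x : nerve3) : L := fib2 (fib1 (fib2 x)).
Definition nerve3_01 (x : nerve3) : L := fib2 (fib2 (fib2 x)).

Lemma nerve3_edge23 x : edge23 (nerve3_base x) = prj L (nerve3_23 x).
Proof. exact: fib_eq. Qed.
Lemma nerve3_edge12 x : edge12 (nerve3_base x) = prj L (nerve3_12 x).
Proof. by rewrite -fib_eq; congr edge12; exact: (fib_eq x). Qed.
Lemma nerve3_edge01 x : edge01 (nerve3_base x) = prj L (nerve3_01 x).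
Proof.
rewrite -fib_eq; congr edge01.
by apply: (etrans (fib_eq x)); exact: (fib_eq (fib2 x)).
Qed.

(** The 2-simplices over [d_0] and [d_3] of the underlying 3-simplex. *)
Lemma nerve3_d0_subproof x :
  sd2 S (o2 0) (sd3 S ord0 (nerve3_base x)) = prj L (nerve3_12 x).
Proof. by rewrite -nerve3_edge12; apply/esym/hS.2. Qed.
Definition nerve3_d0 (x : nerve3) : nerve2 :=
  nerve2_pt (nerve3_edge23 x) (nerve3_d0_subproof x).
Definition nerve3_d3 (x : nerve3) : nerve2 :=
  nerve2_pt (nerve3_edge12 x) (nerve3_edge01 x).

Lemma nerve3_d1_subproof1 x :
  sd2 S ord0 (sd3 S (o1 2) (nerve3_base x)) = prj L (nerve3_23 x).
Proof. by rewrite -nerve3_edge23; apply: hS.2. Qed.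
Lemma nerve3_d1_subproof2 x :
  sd2 S (o2 0) (sd3 S (o1 2) (nerve3_base x)) = prj L (nerve_mul (nerve3_d3 x)).
Proof. by rewrite -nerve_mul_proj; apply/esym/hS.2. Qed.
Definition nerve3_d1 (x : nerve3) : nerve2 :=
  nerve2_pt (nerve3_d1_subproof1 x) (nerve3_d1_subproof2 x).

Lemma nerve3_d2_subproof1 x :
  sd2 S ord0 (sd3 S (o2 1) (nerve3_base x)) = prj L (nerve_mul (nerve3_d0 x)).
Proof. by rewrite -nerve_mul_proj; apply: hS.2. Qed.
Lemma nerve3_d2_subproof2 x :
  sd2 S (o2 0) (sd3 S (o2 1) (nerve3_base x)) = prj L (nerve3_01 x).
Proof. by rewrite -nerve3_edge01; apply/esym/hS.2. Qed.
Definition nerve3_d2 (x : nerve3) : nerve2 :=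
  nerve2_pt (nerve3_d2_subproof1 x) (nerve3_d2_subproof2 x).

Definition nerve_sd1 (i : 'I_2) (l : L) : ss0 S := sd1 S i (prj L l).
Definition nerve_sd2 (i : 'I_3) (x : nerve2) : L :=
  match val i with
  | 0 => fib2 (fib1 x)
  | 1 => nerve_mul x
  | _ => fib2 (fib2 x)
  end.
Definition nerve_sd3 (i : 'I_4) (x : nerve3) : nerve2 :=
  match val i with
  | 0 => nerve3_d0 x
  | 1 => nerve3_d1 x
  | 2 => nerve3_d2 x
  | _ => nerve3_d3 x
  end.

Lemma nerve_sd2_proj i x : prj L (nerve_sd2 i x) = sd2 S i (nerve2_base x).
Proof.
case: i => [[|[|[|//]]] hi]; rewrite /nerve_sd2 /=.
- by rewrite -fib_eq; congr (sd2 S _ _); exact: val_inj.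
- by rewrite -nerve_mul_proj; congr (sd2 S _ _); exact: val_inj.
- rewrite -fib_eq -[fib1 _]/(prj (pull (sd2 S (o2 0)) L) _) -(fib_eq x).
  by congr (sd2 S _ _); exact: val_inj.
Qed.
Lemma nerve_sd3_base i x : nerve2_base (nerve_sd3 i x) = sd3 S i (nerve3_base x).
Proof.
by case: i => [[|[|[|[|//]]]] hi]; rewrite /nerve_sd3 /=;
  congr (sd3 S _ _); exact: val_inj.
Qed.

Definition nerve_sspace : sspace :=
  @SSpace (ss0 S) L nerve2 nerve3 nerve_sd1 nerve_sd2 nerve_sd3.

Lemma nerve_pi_sd2 i x :
  pi1 S (prj L (nerve_sd2 i x)) = fpface i (pi2 S (nerve2_base x)).
Proof. by rewrite nerve_sd2_proj pi_sd2. Qed.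
Lemma nerve_pi_sd3 i x :
  pi2 S (nerve2_base (nerve_sd3 i x)) = fpface i (pi3 S (nerve3_base x)).
Proof. by rewrite nerve_sd3_base pi_sd3. Qed.

Definition nerve : ss_over y :=
  @SSOver _ _ _ nerve_sspace (pi0 S) (pi1 S \o prj L) (pi2 S \o nerve2_base)
    (pi3 S \o nerve3_base) (fun i l => pi_sd1 (s := S) i (prj L l))
    nerve_pi_sd2 nerve_pi_sd3.

Definition nerve_map : ss_map nerve S :=
  @SSMap _ _ _ nerve S id (prj L) nerve2_base nerve3_base
    (fun _ => erefl) (fun _ => erefl) (fun _ => erefl) (fun _ => erefl)
    (fun _ _ => erefl) (fun i x => esym (nerve_sd2_proj i x))
    (fun i x => esym (nerve_sd3_base i x)).
End Nerve.

(** * The rigid bundle 2-gerbe [r_1(B, t)] and its trivialisation *)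

Section R1T.
Context {R : realType} {X : topologicalType}.
Variables (B : bigerbe R X) (t : bitriv B).

Definition r1t_nerve : ss_over (@by1 X B) :=
  nerve (@bsq_simplicial X B) (bt2 t).
Definition r1t_map : ss_map r1t_nerve (bsq_over B) :=
  nerve_map (@bsq_simplicial X B) (bt2 t).

Definition r1t : rigid2gerbe R (@by1 X B) := @pull_gerbe _ _ _ _ (r1 B) _ r1t_map.
Definition r1t_mor : rigid_mor r1t (r1 B) := @pull_gerbe_mor _ _ _ _ (r1 B) _ r1t_map.

(** The canonical trivialisation [(q_0, q_1) |-> q_1 (x) q_0^*] of the pullback
    of [delta_v Q_2] to [Q_2 x Q_2]. *)
Lemma r1t_can_subproof (z : fibpow (pi1 r1t_nerve) 2) (i : 'I_2) :
  vface1_base (S := bsq_over B) i (smpow1 r1t_map z) =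
  prj (bQ2 t) (fpface1 i z).
Proof. by []. Qed.
Definition r1t_can (z : fibpow (pi1 r1t_nerve) 2) :
    delta (@vface1_base _ _ _ (bsq_over B)) (bQ2 t) :=
  @tpure _ _ (pull (@vface1_base _ _ _ (bsq_over B) ord0) (bQ2 t))
    (dual (pull (@vface1_base _ _ _ (bsq_over B) (lift ord0 ord0)) (bQ2 t)))
    (fpair (r1t_can_subproof z ord0))
    (fpair (r1t_can_subproof z (lift ord0 ord0)))
    erefl.
Lemma r1t_can_proj z :
  prj (delta (@vface1_base _ _ _ (bsq_over B)) (bQ2 t)) (r1t_can z) =
  smpow1 r1t_map z.
Proof. by apply: (etrans (prj_tpure _)). Qed.

(** [E' -> delta_h Q_1] over [Q_2 x Q_2 -> W^[2,2]], obtained from [bphi] and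
    [r1t_can]. *)
Lemma r1t_phi_subproof (e : rE r1t) :
  prj (bE B) (fib2 e) =
  prj (delta (@vface1_base _ _ _ (bsq_over B)) (bQ2 t))
    (r1t_can (prj (rE r1t) e)).
Proof. by rewrite r1t_can_proj -fib_eq. Qed.
Definition r1t_phi_fun (e : rE r1t) : delta (@hface1 _ _ _ (bsq_over B) 2) (bQ1 t) :=
  bphi t (tpure (r1t_phi_subproof e)).
Lemma r1t_phi_proj e :
  prj (delta (@hface1 _ _ _ (bsq_over B) 2) (bQ1 t)) (r1t_phi_fun e) =
  smpow1 r1t_map (prj (rE r1t) e).
Proof. by rewrite bmap_proj prj_tpure -fib_eq. Qed.
Lemma r1t_phi_act u e : r1t_phi_fun (uact u e) = uact u (r1t_phi_fun e).
Proof.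
rewrite /r1t_phi_fun -bmap_act; congr (bphi t _).
have h : prj (bE B) (uact u (fib2 e)) =
    prj (delta (@vface1_base _ _ _ (bsq_over B)) (bQ2 t))
      (r1t_can (prj (rE r1t) e)).
  by rewrite prj_act r1t_phi_subproof.
rewrite (uact_tpure _ h); apply: (tpure_eq _ _ (u := u1_one)).
  by rewrite uact1.
by rewrite u1_inv1 uact1 prj_act.
Qed.
Definition r1t_phi :
    bmap (@smpow1 _ _ _ _ _ r1t_map 2) (rE r1t)
         (delta (@hface1 _ _ _ (bsq_over B) 2) (bQ1 t)) :=
  Bmap r1t_phi_proj r1t_phi_act.

Lemma r1t_hface (i : 'I_2) (z : fibpow (pi1 r1t_nerve) 2) :
  hface1 (S := bsq_over B) i (smpow1 r1t_map z) =
  id (hface1 (S := r1t_nerve) i z).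
Proof. exact: fibpow_inj. Qed.

Definition r1t_triv : rigid_triv r1t :=
  @RigidTriv _ _ _ _ r1t (bQ1 t) (bt1 t)
    (lift_bmap
       (bmap_delta (h := @smpow1 _ _ _ _ _ r1t_map 2) (g := id)
          (d := @hface1 _ _ _ r1t_nerve 2)
          (d' := @hface1 _ _ _ (bsq_over B) 2) r1t_hface (bmap_id (bQ1 t)))
       r1t_phi).
End R1T.

(* Main.v *)
Require Import Defs.
From mathcomp Require Import all_boot all_order all_algebra.
From mathcomp Require Import generic_quotient.
From mathcomp Require Import all_classical reals topology normedtype complex.
From mathcomp Require Import ring.

(** Every equation in the theorem compares two points in one fibre of an iterated
    [delta], so it can be checked in coordinates.  A section [e] of a bundle
    induces the section [delta_sec d e] of [delta d E], and relative to it a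
    section of [delta d E] is a U(1)-valued function.  In such coordinates
    [delta] of a section is an alternating product ([coord_delta_sec]), the
    canonical sections become 1 ([coord_delta_one]), the canonical isomorphisms
    disappear ([coord_delta_swap], [coord_delta_tens]), and a bundle map
    multiplies by [delta] of its coefficient ([coord_bmap_delta_id]).

    Let [k] be the coordinate function of [Q_2] on its own total space
    [Q_2 = N(Q_2)_1].  The multiplication of [N(Q_2)] is defined so that, on
    [N(Q_2)_2], the alternating product of [k] over the three faces is the
    coordinate of [t_2] ([coord_nerve_mul]); its associativity, and with it the
    simplicial identities, is then the cocycle condition on [t_2]
    ([nerve_mulA]).  The isomorphism [E' -> delta_h Q_1] has the coefficient
    [v * delta_v k], where [v] is the coefficient of the given isomorphism
    [E (x) delta_v Q_2 -> delta_h Q_1] ([coord_r1t_iso]).  It is compatible with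
    the bundle gerbe multiplications because [delta_v (delta_v k) = 1], and with
    [M] because [delta_h (delta_v k) = delta_v (delta_h k)] is [delta_v] of the
    coordinate of [t_2], so that both conditions are the ones imposed on the
    trivialisation of the bigerbe.  The other equations pull back along
    [N(Q_2) -> W^[n+1,1]] ([pull_gerbe_rigid]).

    The topological conditions reduce to charts, that is, to sections that are
    continuous together with the coordinate that they define.  Near finitely many
    points a bundle on a Hausdorff space has a single chart ([common_chart]); hence
    [delta_sec d e] can be made a chart of [delta d E] near any point
    ([delta_chart]), and a section or a bundle map is continuous as soon as its
    coordinates are.  Since fibre products carry the compactly generated topology,
    maps into them are shown to be continuous on open sets of compactly generated
    Hausdorff spaces, where the refinement of the topology is not seen
    ([ncont_kspace]).  The space [W^[n+1,1]] covers [Y_1^[n+1]] because a local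
    section of [Y_2 -> X] followed by local sections of [W -> Y_1 x_X Y_2] lifts
    several points of [Y_1] to one fibre of [W -> Y_2] ([bsq_pi_cover]). *)

Set Implicit Arguments.
Unset Strict Implicit.
Unset Printing Implicit Defensive.
Import Order.TTheory GRing.Theory Num.Theory.
Import numFieldNormedType.Exports.
Local Open Scope quotient_scope.
Local Open Scope classical_set_scope.
Local Open Scope ring_scope.

(** * Compactly generated topologies *)

Section KspaceTheory.
Variable T : topologicalType.

Lemma open_kopen (O : set T) : open O -> kopen O.
Proof. by move=> oO K _; exists O. Qed.

Lemma kspace_id_continuous : continuous (id : kspace T -> T).
Proof. by apply/continuousP => O oO; exact: open_kopen. Qed.

Lemma compact_kspace (K : set T) : compact K -> compact (K : set (kspace T)).
Proof.
move=> cK F PF FK; have [x [Kx clx]] := cK F PF FK; exists x; split=> // B N FB.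
rewrite nbhsE => -[O [oO Ox] ON]; have [V oV e] := oO K cK.
have [y [[By Ky] Vy]] : (B `&` K) `&` V !=set0.
  apply: clx; first exact: filterI.
  apply: open_nbhs_nbhs; split=> //.
  by have [] : (V `&` K) x by rewrite -e.
by exists y; split=> //; apply: ON; have [] : (O `&` K) y by rewrite e.
Qed.

Lemma cgh_kspace : hausdorff_space T -> cgh (kspace T).
Proof.
move=> hT; split.
  move=> x y cl; apply: hT => A B nA nB; apply: cl.
    exact: (kspace_id_continuous nA).
  exact: (kspace_id_continuous nB).
move=> O kO; apply: (_ : @kopen T O) => K cK; have [U oU OU] := kO K (compact_kspace cK).
by have [V oV UV] := oU K cK; exists V => //; rewrite OU.
Qed.

(** Local compactness of [K] near [x], with the compact neighbourhood inside a
    given open set [U]: [x] is separated from the compact set [K `\` U]. *)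
Lemma compact_local (K U : set T) x : hausdorff_space T -> compact K -> open U ->
  U x -> exists V, [/\ open V, V x & exists2 N, compact N &
    V `&` K `<=` N /\ N `<=` U `&` K].
Proof.
move=> hT cK oU Ux.
have : compact (K `\` U).
  apply: (subclosed_compact _ cK) => //.
  by apply: closedI; [exact: compact_closed | exact: open_closedC].
move=> /compact_near_coveringP
  /(_ _ (powerset_filter_from (nbhs x)) (fun W y => ~ closure W y))[].
  move=> y [Ky Uy]; have /eqP xy : y <> x by move=> e; apply: Uy; rewrite e.
  have := hT; rewrite open_hausdorff => /(_ _ _ xy)[[A B]] /=.
  rewrite !inE => -[Ay Bx] [oA oB AB].
  exists (A, [set W | nbhs x W /\ W `<=` B]).
    split; first exact: open_nbhs_nbhs.
    by apply: powerset_filter_fromP; exact: open_nbhs_nbhs.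
  move=> [y' W] /= [Ay' [_ WB]] /(_ A (open_nbhs_nbhs (conj oA Ay')))[z [Wz Az]].
  have : (A `&` B) z by split=> //; exact: WB.
  by rewrite AB.
move=> M [Mx _ [W MW]] /(_ _ MW) KUW.
have := Mx W MW; rewrite nbhsE => -[V [oV Vx] VW].
exists V; split=> //; exists (K `&` closure W).
  by apply: compact_closedI => //; exact: closed_closure.
split=> y [].
  by move=> Vy Ky; split=> //; apply: subset_closure; exact: VW.
move=> Ky cWy; split=> //; apply: contrapT => Uy.
by apply: (KUW y).
Qed.
End KspaceTheory.

Lemma kopen_preimage (S T : topologicalType) (f : S -> T) (O : set T) :
  continuous f -> kopen O -> kopen (f @^-1` O).
Proof.
move=> cf kO K cK.
have cfK : compact (f @` K).
  by apply: continuous_compact => //; exact: continuous_subspaceT.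
have [V oV e] := kO _ cfK; exists (f @^-1` V).
  by move/continuousP: cf; apply.
rewrite predeqE => x; split=> -[Ox Kx]; split=> //.
  by have [] : (V `&` f @` K) (f x) by rewrite -e; split=> //; exists x.
by have [] : (O `&` f @` K) (f x) by rewrite e; split=> //; exists x.
Qed.

(** * Continuity near a point *)

Section NearContinuity.
Implicit Types S T U : topologicalType.

(** Continuity near a point.  Continuity at a single point does not survive the
    passage to a compactly generated topology, continuity near a point does. *)
Definition ncont S T (f : S -> T) (x : S) : Prop :=
  nbhs x [set y | {for y, continuous f}].

Lemma ncont_open S T (f : S -> T) x : ncont f x ->
  exists O, [/\ open O, O x & forall y, O y -> {for y, continuous f}].
Proof. by rewrite /ncont nbhsE => -[O [oO Ox] h]; exists O. Qed.

Lemma open_ncont S T (f : S -> T) (O : set S) x : open O -> O x ->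
  (forall y, O y -> {for y, continuous f}) -> ncont f x.
Proof.
by move=> oO Ox h; rewrite /ncont nbhsE; exists O => // y /h.
Qed.

Lemma continuous_ncont S T (f : S -> T) x : continuous f -> ncont f x.
Proof. by move=> cf; apply: filterE => y; exact: cf. Qed.

Arguments continuous_ncont {S T f} x _.

Lemma ncont_at S T (f : S -> T) x : ncont f x -> {for x, continuous f}.
Proof. exact: nbhs_singleton. Qed.

Lemma ncont_continuous S T (f : S -> T) : (forall x, ncont f x) -> continuous f.
Proof. by move=> h x; exact: ncont_at. Qed.

Lemma near_near S (P : set S) (x : S) : nbhs x P -> \forall y \near x, nbhs y P.
Proof. exact: nbhs_interior. Qed.

Lemma near_comp S T (f : S -> T) (x : S) (P : set T) :
  {for x, continuous f} -> nbhs (f x) P -> \forall y \near x, P (f y).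
Proof. by move=> cf; exact: cf. Qed.

Lemma continuous_at_ext S T (f g : S -> T) (x : S) : (\forall y \near x, f y = g y) ->
  {for x, continuous f} -> {for x, continuous g}.
Proof.
move=> e cf; have ex : f x = g x := nbhs_singleton e.
move=> A; rewrite -ex => /cf fA.
apply: (filterS (P := [set y | f y = g y /\ A (f y)]) (F := nbhs x)).
  by move=> y [/= <-].
exact: filterI e fA.
Qed.

Lemma ncont_ext S T (f g : S -> T) (x : S) : (\forall y \near x, f y = g y) ->
  ncont f x -> ncont g x.
Proof.
move=> /near_near e cf; near=> y; apply: (continuous_at_ext (f := f)).
  by near: y.
by near: y.
Unshelve. all: by end_near. Qed.

Lemma ncont_comp S T U (f : S -> T) (g : T -> U) x :
  ncont f x -> ncont g (f x) -> ncont (g \o f) x.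
Proof.
move=> cf cg; near=> y.
have cfy : {for y, continuous f} by near: y.
by apply: continuous_comp => //; near: y; exact: (near_comp (ncont_at cf) cg).
Unshelve. all: by end_near. Qed.

Lemma ncont_pair S T U (f : S -> T) (g : S -> U) x :
  ncont f x -> ncont g x -> ncont (fun y => (f y, g y)) x.
Proof.
move=> cf cg; near=> y.
by apply: (@cvg_pair _ _ _ (nbhs y) (nbhs (f y)) (nbhs (g y))); near: y.
Unshelve. all: by end_near. Qed.

(** The topology of [T] and its compactly generated refinement agree on the image
    of a compact set.  Since [f] is controlled only on an open set [O],
    the compact sets in question have to be shrunk into [O] first. *)
Lemma ncont_kspace S T (f : S -> T) x :
  cgh S -> ncont f x -> ncont (f : S -> kspace T) x.
Proof.
move=> [hS kS] /ncont_open[O [oO Ox cf]]; apply: (open_ncont oO Ox) => y Oy.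
move=> A; rewrite nbhsE => -[V [kV Vfy] VA].
apply: (filterS (P := O `&` f @^-1` V)); first by move=> z [_ /VA].
apply: open_nbhs_nbhs; split=> //; apply: kS => K cK.
(* the union of the open sets whose trace on [K] lies in the preimage of [V] *)
pose Q := [set W : set S | open W /\ W `&` K `<=` O `&` f @^-1` V].
exists (\bigcup_(W in Q) W); first by apply: bigcup_open => W [].
rewrite predeqE => z; split=> [[[Oz Vfz] Kz]|]; last first.
  by move=> [[W [oW WV] Wz] Kz]; split=> //; exact: WV.
split=> //; have [W [oW Wz [N cN [WN NO]]]] := compact_local hS cK oO Oz.
have cfN : compact (f @` N).
  apply: continuous_compact => //; apply/subspace_continuousP => t Nt B Bf.
  have hB : nbhs t (f @^-1` B) := cf t (NO t Nt).1 B Bf.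
  have : within N (nbhs t) (f @^-1` B) by apply: filterS hB => z' Bz _.
  exact.
have [V' oV' e] := kV _ cfN.
have VV' t : N t -> V (f t) <-> V' (f t).
  move=> Nt; have : (V `&` f @` N) (f t) <-> (V' `&` f @` N) (f t) by rewrite e.
  have ft : (f @` N) (f t) by exists t.
  by move=> [h1 h2]; split=> h; [case: h1|case: h2].
exists (W `&` (O `&` f @^-1` V')).
  split.
    apply: openI => //; rewrite openE => t [Ot V't].
    apply: filterI; first exact: open_nbhs_nbhs.
    by apply: cf => //; exact: open_nbhs_nbhs.
  by move=> t [[Wt [Ot V't]] Kt]; split=> //; apply/VV' => //; exact: WN.
by split=> //; split=> //; apply/VV' => //; exact: WN.
Qed.

Lemma ncont_set_type S T (A : set T) (f : S -> A) x :
  ncont (fun y => set_val (f y)) x -> ncont f x.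
Proof.
move=> /ncont_open[O [oO Ox cf]]; apply: (open_ncont oO Ox) => y Oy.
move=> B [B' [[C oC <-] /= Cfy] CB]; rewrite nbhs_simpl.
apply: (filterS (P := fun t => C (set_val (f t)))); first by move=> t; apply: CB.
exact: (cf y Oy _ (open_nbhs_nbhs (conj oC Cfy))).
Qed.
End NearContinuity.

Lemma set_val_continuous (T : topologicalType) (A : set T) :
  continuous (set_val : A -> T).
Proof. exact: initial_continuous. Qed.

Lemma hausdorff_inj (S T : topologicalType) (f : S -> T) :
  continuous f -> injective f -> hausdorff_space T -> hausdorff_space S.
Proof.
move=> cf fI hT x y cl; apply/fI/hT => A B nA nB.
by have [z [Az Bz]] := cl _ _ (cf x _ nA) (cf y _ nB); exists (f z).
Qed.

Lemma hausdorff_prod (S T : topologicalType) :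
  hausdorff_space S -> hausdorff_space T -> hausdorff_space (S * T)%type.
Proof.
move=> hS hT [x x'] [y y'] cl; congr pair.
  apply: hS => A B nA nB.
  have [[z z'] [Az Bz]] := cl _ _ (cvg_fst nA) (cvg_fst nB).
  by exists z.
apply: hT => A B nA nB.
have [[z z'] [Az Bz]] := cl _ _ (cvg_snd nA) (cvg_snd nB).
by exists z'.
Qed.

Lemma kspace_fst_continuous (S T : topologicalType) :
  continuous (fst : kspace (S * T)%type -> S).
Proof.
move=> p; have c : {for (p : S * T), continuous fst} by exact: cvg_fst.
exact: (continuous_comp (@kspace_id_continuous _ p) c).
Qed.

Lemma kspace_snd_continuous (S T : topologicalType) :
  continuous (snd : kspace (S * T)%type -> T).
Proof.
move=> p; have c : {for (p : S * T), continuous snd} by exact: cvg_snd.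
exact: (continuous_comp (@kspace_id_continuous _ p) c).
Qed.

(** * Fibre products *)

Section FibProdTheory.
Variables (A B C : topologicalType) (f : A -> C) (g : B -> C).

Lemma cgh_fibprod : hausdorff_space A -> hausdorff_space B -> cgh (fibprod f g).
Proof.
move=> hA hB; apply: cgh_kspace.
apply: (@hausdorff_inj _ (A * B)%type set_val).
- exact: set_val_continuous.
- exact: val_inj.
- exact: hausdorff_prod.
Qed.

Lemma fib_val_continuous :
  continuous (set_val : fibprod f g -> (A * B)%type).
Proof.
move=> x; exact: (continuous_comp (@kspace_id_continuous _ x)
                                  (@set_val_continuous _ _ x)).
Qed.

Lemma fib1_continuous : continuous (@fib1 _ _ _ f g).
Proof. by move=> x; exact: (continuous_comp (@fib_val_continuous x) cvg_fst). Qed.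

Lemma fib2_continuous : continuous (@fib2 _ _ _ f g).
Proof. by move=> x; exact: (continuous_comp (@fib_val_continuous x) cvg_snd). Qed.

Lemma ncont_fibprod (S : topologicalType) (h : S -> fibprod f g) x : cgh S ->
  ncont (fun y => fib1 (h y)) x -> ncont (fun y => fib2 (h y)) x -> ncont h x.
Proof.
move=> cS c1 c2; apply: ncont_kspace => //; apply: ncont_set_type.
apply: ncont_ext (ncont_pair c1 c2).
by apply: filterE => y; rewrite /fib1 /fib2 -surjective_pairing.
Qed.

Lemma continuous_fibprod (S : topologicalType) (h : S -> fibprod f g) : cgh S ->
  continuous (fun y => fib1 (h y)) -> continuous (fun y => fib2 (h y)) ->
  continuous h.
Proof.
move=> cS c1 c2; apply: ncont_continuous => x.
by apply: ncont_fibprod => //; exact: continuous_ncont.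
Qed.

(** [fpair] needs compatible components everywhere; local sections of covers are
    compatible only near a point. *)
Lemma local_fpair (S : topologicalType) (a : S -> A) (b : S -> B) (x : S) : cgh S ->
  ncont a x -> ncont b x -> (\forall y \near x, f (a y) = g (b y)) ->
  exists h : S -> fibprod f g, [/\ ncont h x,
    (\forall y \near x, fib1 (h y) = a y) & (\forall y \near x, fib2 (h y) = b y)].
Proof.
move=> cS ca cb e; pose h0 := fpair (nbhs_singleton e).
have /choice[h hP] : forall y, exists p : fibprod f g,
    f (a y) = g (b y) -> fib1 p = a y /\ fib2 p = b y.
  move=> y; have [ey|] := pselect (f (a y) = g (b y)); first by exists (fpair ey).
  by exists h0.
have h1 : \forall y \near x, fib1 (h y) = a y by apply: (filterS _ e) => y /hP[].
have h2 : \forall y \near x, fib2 (h y) = b y by apply: (filterS _ e) => y /hP[].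
exists h; split=> //; apply: ncont_fibprod => //.
  by apply: ncont_ext ca; apply: filterS h1.
by apply: ncont_ext cb; apply: filterS h2.
Qed.
End FibProdTheory.

Section FibPowTheory.
Variables (A B : topologicalType) (f : A -> B) (k : nat).

Lemma cgh_fibpow : hausdorff_space A -> cgh (fibpow f k).
Proof.
move=> hA; apply: cgh_kspace.
apply: (@hausdorff_inj _ {ptws 'I_k -> A} set_val).
- exact: set_val_continuous.
- exact: val_inj.
- exact: (@hausdorff_product 'I_k (fun=> A)).
Qed.

Lemma fpev_continuous i : continuous (fun a : fibpow f k => fpev a i).
Proof.
have cv : continuous (set_val : fibpow f k -> {ptws 'I_k -> A}).
  move=> x; exact: (continuous_comp (@kspace_id_continuous _ x)
                                    (@set_val_continuous _ _ x)).
move=> x; exact: (continuous_comp (cv x) (@proj_continuous 'I_k (fun=> A) i _)).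
Qed.

Lemma ncont_fibpow (S : topologicalType) (h : S -> fibpow f k) x : cgh S ->
  (forall i, ncont (fun y => fpev (h y) i) x) -> ncont h x.
Proof.
move=> cS ch; apply: ncont_kspace => //; apply: ncont_set_type.
have : \forall y \near x, forall i, {for y, continuous (fun y => fpev (h y) i)}.
  exact: filter_forall.
apply: filterS => y cy.
apply/(@cvg_sup _ _ _ _ _ (fmap_filter _ _)) => i V [V' [[C oC <-] /= Ci] CV].
rewrite nbhs_simpl; apply: (filterS (P := fun z => C (fpev (h z) i))).
  by move=> z; exact: CV.
exact: (cy i _ (open_nbhs_nbhs (conj oC Ci))).
Qed.

Lemma continuous_fibpow (S : topologicalType) (h : S -> fibpow f k) : cgh S ->
  (forall i, continuous (fun y => fpev (h y) i)) -> continuous h.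
Proof.
move=> cS c; apply: ncont_continuous => x.
by apply: ncont_fibpow => // i; exact: continuous_ncont.
Qed.

Lemma local_fptup (S : topologicalType) (a : 'I_k -> S -> A) (x : S) : cgh S ->
  (forall i, ncont (a i) x) ->
  (\forall y \near x, forall i j, f (a i y) = f (a j y)) ->
  exists h : S -> fibpow f k, ncont h x /\
    \forall y \near x, forall i, fpev (h y) i = a i y.
Proof.
move=> cS ca e; pose h0 := fptup (nbhs_singleton e).
have /choice[h hP] : forall y, exists p : fibpow f k,
    (forall i j, f (a i y) = f (a j y)) -> forall i, fpev p i = a i y.
  move=> y; have [ey|] := pselect (forall i j, f (a i y) = f (a j y)).
    by exists (fptup ey).
  by exists h0.
have hE : \forall y \near x, forall i, fpev (h y) i = a i y.
  by apply: (filterS _ e) => y /hP.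
exists h; split=> //; apply: ncont_fibpow => // i.
by apply: ncont_ext (ca i); apply: filterS hE => y ->.
Qed.
End FibPowTheory.

Lemma fpface_continuous (A B : topologicalType) (f : A -> B) k (i : 'I_k.+1) :
  hausdorff_space A -> continuous (@fpface _ _ f k i).
Proof.
move=> hA; apply: continuous_fibpow; first exact: cgh_fibpow.
by move=> j; exact: fpev_continuous.
Qed.

Lemma fpface1_continuous (A B : topologicalType) (f : A -> B) (i : 'I_2) :
  continuous (@fpface1 _ _ f i).
Proof. exact: fpev_continuous. Qed.

Lemma fpev_map (A B A' B' : topologicalType) (f : A -> B) (f' : A' -> B')
    (g : A -> A') (h : B -> B') (gh : forall a, f' (g a) = h (f a)) k
    (a : fibpow f k) j : fpev (@fpmap _ _ _ _ f f' g h gh k a) j = g (fpev a j).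
Proof. by []. Qed.

Lemma fpmap_continuous (A B A' B' : topologicalType) (f : A -> B) (f' : A' -> B')
    (g : A -> A') (h : B -> B') (gh : forall a, f' (g a) = h (f a)) k :
  hausdorff_space A -> continuous g -> continuous (@fpmap _ _ _ _ f f' g h gh k).
Proof.
move=> hA cg; apply: continuous_fibpow; first exact: cgh_fibpow.
by move=> i x; exact: (continuous_comp (@fpev_continuous _ _ _ _ i x) (cg _)).
Qed.

(** * Covers *)

Lemma cover_section (Y X : topologicalType) (f : Y -> X) (x : X) : is_cover f ->
  exists s : X -> Y, ncont s x /\ \forall y \near x, f (s y) = y.
Proof.
move=> [_ _ _ /(_ x)[U [s [oU Ux cs fs]]]]; exists s; split.
  apply: (open_ncont oU Ux) => y Uy.
  by move: cs; rewrite continuous_open_subspace // => /(_ y (mem_set Uy)).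
by apply: (filterS (P := U)) => [y /mem_set /fs|]; last exact: open_nbhs_nbhs.
Qed.

Lemma coverI (Y X : topologicalType) (f : Y -> X) : cgh Y -> cgh X ->
  continuous f -> (forall x : X, exists s : X -> Y,
    ncont s x /\ \forall y \near x, f (s y) = y) -> is_cover f.
Proof.
move=> cY cX cf h; split=> // x; have [s [/ncont_open[O [oO Ox cs]] fs]] := h x.
have : nbhs x [set y | f (s y) = y] by []; rewrite nbhsE => -[V [oV Vx] fV].
exists (O `&` V), s; split; first exact: openI.
- by [].
- rewrite continuous_open_subspace; last exact: openI.
  by move=> y; rewrite inE => -[Oy _]; exact: cs.
by move=> y; rewrite inE => -[_ /fV].
Qed.

Lemma cover_comp (Z Y X : topologicalType) (f : Z -> Y) (g : Y -> X) :
  is_cover f -> is_cover g -> is_cover (g \o f).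
Proof.
move=> hf hg; have [cZ _ cf _] := hf; have [cY cX cg _] := hg.
apply: coverI => // [x|x].
  by apply: continuous_comp; [exact: cf|exact: cg].
have [s [cs gs]] := cover_section x hg.
have [t [ct ft]] := cover_section (s x) hf.
exists (t \o s); split; first exact: ncont_comp.
have ft' := near_comp (ncont_at cs) ft.
near=> y; have fts : f (t (s y)) = s y by near: y.
by rewrite /= fts; near: y.
Unshelve. all: by end_near. Qed.

(** * Coordinates with respect to a section *)

Section Coordinates.
Context {R : realType}.
Implicit Types X : topologicalType.
Implicit Types u v : U1 R.

Lemma u1_valM u v : u1_val (u1_mul u v) = u1_val u * u1_val v.
Proof. by []. Qed.
Lemma u1_valV u : u1_val (u1_inv u) = (u1_val u)^-1.
Proof. by []. Qed.
Lemma u1_1mul u : u1_mul u1_one u = u.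
Proof. by rewrite u1_mulC u1_mul1. Qed.

(** The coordinate [c] in [p = c . s(prj p)]; it trivialises the bundle
    algebraically, whether or not [s] is continuous. *)
Definition coord X (P : prebundle R X) (s : section P) (p : P) : U1 R :=
  uratio (secK s (prj P p)).

Section Coord.
Variables (X : topologicalType) (P : prebundle R X) (s : section P).

Lemma coordP p : p = uact (coord s p) (s (prj P p)).
Proof. exact: uratioP. Qed.

Lemma coord_unique u p : p = uact u (s (prj P p)) -> coord s p = u.
Proof. by rewrite {1}(coordP p) => /uact_regular. Qed.

Lemma coord_act u p : coord s (uact u p) = u1_mul u (coord s p).
Proof. by apply: coord_unique; rewrite prj_act -uactM -coordP. Qed.

Lemma coord_sec x : coord s (s x) = u1_one.
Proof. by apply: coord_unique; rewrite secK uact1. Qed.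

Lemma coord_inj p q : prj P p = prj P q -> coord s p = coord s q -> p = q.
Proof. by move=> epq ec; rewrite (coordP p) (coordP q) epq ec. Qed.

Lemma sec_coord (t : section P) x : t x = uact (coord s (t x)) (s x).
Proof. by rewrite -{3}(secK t x) -coordP. Qed.
End Coord.

Lemma coord_pull X X' (f : X' -> X) (P : prebundle R X) (s : section P)
  (p : pull f P) : coord (pull_sec f s) p = coord s (fib2 p).
Proof.
apply: coord_unique; apply: fibprod_inj => //.
by rewrite {1}(coordP s (fib2 p)) -fib_eq.
Qed.

Lemma coord_dual X (P : prebundle R X) (s : section P) (p : P) :
  @coord X (dual P) (dual_sec s) p = u1_inv (coord s p).
Proof.
apply: (@coord_unique X (dual P)).
by rewrite {1}(coordP s p) /= -{1}[coord s p]u1_invK.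
Qed.

Lemma coord_tens X (P Q : prebundle R X) (s : section P) (t : section Q) p q
    (e : prj P p = prj Q q) :
  coord (tens_sec s t) (tpure e) = u1_mul (coord s p) (coord t q).
Proof.
apply: coord_unique; rewrite prj_tpure.
have e' : prj P (uact (u1_mul (coord s p) (coord t q)) (s (prj P p))) =
    prj Q (t (prj P p)) by rewrite prj_act !secK.
rewrite [RHS](uact_tpure (tens_sec_subproof s t _) e').
apply: (tpure_eq _ _ (u := coord t q)).
  by rewrite u1_mulC -uactM -coordP.
by rewrite e [X in uact _ X](coordP t q) uactM u1_mulC u1_mulV uact1.
Qed.

Lemma coord_tens_sec X (P Q : prebundle R X) (s s' : section P)
    (t t' : section Q) x : coord (tens_sec s t) (tens_sec s' t' x) =
  u1_mul (coord s (s' x)) (coord t (t' x)).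
Proof. exact: coord_tens. Qed.

(** ** Related sections *)

Section Related.
Variables (X X' : topologicalType) (g : X -> X').
Variables (P : prebundle R X) (P' : prebundle R X') (F : bmap g P P').

Lemma coord_bmap (s : section P) (s' : section P') p :
  (forall x, F (s x) = s' (g x)) -> coord s' (F p) = coord s p.
Proof.
move=> h; apply: coord_unique.
by rewrite {1}(coordP s p) bmap_act h bmap_proj.
Qed.

Lemma coord_lift_sec (s : section P) (s' t : section P') x :
  (forall x, F (s x) = s' (g x)) ->
  coord s (lift_sec F t x) = coord s' (t (g x)).
Proof.
by move=> h; rewrite -(coord_bmap _ h); congr (coord _ _); exact: lift_ptK.
Qed.
End Related.

Lemma bmap_secE X (P Q : prebundle R X) (F : bmap id P Q) (s : section P) x :
  bmap_sec F s x = F (s x).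
Proof. by []. Qed.

Lemma bmap_tens_sec X X' (g : X -> X') (P Q : prebundle R X)
    (P' Q' : prebundle R X') (F : bmap g P P') (G : bmap g Q Q')
    (s : section P) (s' : section P') (t : section Q) (t' : section Q') :
  (forall x, F (s x) = s' (g x)) -> (forall x, G (t x) = t' (g x)) ->
  forall x, bmap_tens F G (tens_sec s t x) = tens_sec s' t' (g x).
Proof.
move=> Fs Gt x.
have e' : prj P' (F (s x)) = prj Q' (G (t x)) by rewrite !bmap_proj !secK.
apply: (etrans (bmap_tens_tpure (tens_sec_subproof s t x) e')).
by apply: (tpure_eq _ _ (u := u1_one)); rewrite ?u1_inv1 uact1.
Qed.

Lemma bmap_signed_sec X X' b (g : X -> X') (P : prebundle R X)
    (P' : prebundle R X') (F : bmap g P P') (s : section P) (s' : section P') :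
  (forall x, F (s x) = s' (g x)) ->
  forall x, bmap_signed b F (signed_sec b s x) = signed_sec b s' (g x).
Proof. by case: b. Qed.

(** Naturality of [delta] on sections: this makes the coordinates relative to
    induced sections invariant under bundle maps. *)
Lemma bmap_delta_sec (A A' : topologicalType) X X' k (h : A -> A') (g : X -> X')
    (d : 'I_k.+1 -> A -> X) (d' : 'I_k.+1 -> A' -> X')
    (e : forall i a, d' i (h a) = g (d i a))
    (P : prebundle R X) (P' : prebundle R X') (F : bmap g P P')
    (s : section P) (s' : section P') :
  (forall x, F (s x) = s' (g x)) ->
  forall a, bmap_delta e F (delta_sec d s a) = delta_sec d' s' (h a).
Proof.
move=> Fs; rewrite /bmap_delta /delta_sec /delta; move: true => b.
have ps (i : 'I_k.+1) a :
    bmap_pull (e i) F (pull_sec (d i) s a) = pull_sec (d' i) s' (h a).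
  by apply: fibprod_inj => //=; rewrite [LHS]/fib2 /= Fs -e.
elim: k b d d' e ps => [|k IH] b d d' e ps a /=; first exact: bmap_signed_sec.
apply: bmap_tens_sec => [|y]; first exact: bmap_signed_sec.
by apply: IH => i w; exact: ps.
Qed.

(** ** Coordinates of sections of [delta E] *)

Section DeltaCoord.
Variables (X' X : topologicalType) (k : nat) (d : 'I_k.+1 -> X' -> X).

Lemma coord_delta_sec (E : prebundle R X) (s t : section E) z :
  coord (delta_sec d s) (delta_sec d t z) =
  delta_fun true d (fun x => coord s (t x)) z.
Proof.
rewrite (delta_sec_act d (u := fun x => coord s (t x)) (s := s)); last first.
  exact: sec_coord.
by rewrite coord_act coord_sec u1_mul1.
Qed.

(** The coefficient of [f] is the coordinate of the section [f \o s], and [delta]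
    of [f] takes [delta_sec d s] to [delta] of that section. *)
Lemma coord_bmap_delta_id (E F : prebundle R X) (f : bmap id E F)
    (s : section E) (t : section F) p :
  coord (delta_sec d t) (bmap_delta_id d f p) =
  u1_mul (coord (delta_sec d s) p)
    (delta_fun true d (fun x => coord t (f (s x))) (prj (delta d E) p)).
Proof.
rewrite {1}(coordP (delta_sec d s) p) bmap_act coord_act; congr u1_mul.
have -> x : bmap_delta_id d f (delta_sec d s x) = delta_sec d (bmap_sec f s) x.
  exact: bmap_delta_sec.
exact: coord_delta_sec.
Qed.

Lemma coord_delta_tens (E F : prebundle R X) (e : section E) (f : section F) p :
  coord (delta_sec d (tens_sec e f)) (delta_tens d E F p) =
  coord (tens_sec (delta_sec d e) (delta_sec d f)) p.
Proof. by apply: coord_bmap => z; exact: delta_tensE. Qed.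
End DeltaCoord.

Lemma delta_funM X' X b k (d : 'I_k.+1 -> X' -> X) (u v : X -> U1 R) z :
  delta_fun b d (fun x => u1_mul (u x) (v x)) z =
  u1_mul (delta_fun b d u z) (delta_fun b d v z).
Proof.
apply: u1_inj; rewrite u1_valM !u1_val_delta_fun -big_split.
by apply: eq_bigr => i _ /=; case: ifP => //; rewrite u1_valM invfM.
Qed.

Lemma delta_fun_map (A A' : topologicalType) X X' b k (h : A -> A') (g : X -> X')
    (d : 'I_k.+1 -> A -> X) (d' : 'I_k.+1 -> A' -> X') (u : X' -> U1 R) a :
  (forall i a, d' i (h a) = g (d i a)) ->
  delta_fun b d (fun x => u (g x)) a = delta_fun b d' u (h a).
Proof.
move=> e; apply: u1_inj; rewrite !u1_val_delta_fun.
by apply: eq_bigr => i _; rewrite e.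
Qed.

(** Both sides are the product over all pairs of faces, with the same signs. *)
Lemma delta_fun_swap (X11 X10 X01 : topologicalType) X k l
    (v' : 'I_l.+1 -> X11 -> X10) (h : 'I_k.+1 -> X10 -> X)
    (h' : 'I_k.+1 -> X11 -> X01) (v : 'I_l.+1 -> X01 -> X) (u : X -> U1 R) z :
  (forall i j z, h i (v' j z) = v j (h' i z)) ->
  delta_fun true v' (delta_fun true h u) z =
  delta_fun true h' (delta_fun true v u) z.
Proof.
move=> hv; apply: u1_inj; rewrite !u1_val_delta_fun.
have E (b : bool) (I : finType) (F : I -> R[i]) :
    (if b then \prod_i F i else (\prod_i F i)^-1) =
    \prod_i (if b then F i else (F i)^-1).
  by case: b => //; rewrite prodfV.
under eq_bigr => j _ do rewrite u1_val_delta_fun E.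
under [RHS]eq_bigr => i _ do rewrite u1_val_delta_fun E.
rewrite exchange_big; apply: eq_bigr => i _; apply: eq_bigr => j _ /=.
by rewrite hv; do 2!case: odd.
Qed.

Lemma coord_delta_swap (X11 X10 X01 : topologicalType) X k l
    (v' : 'I_l.+1 -> X11 -> X10) (h : 'I_k.+1 -> X10 -> X)
    (h' : 'I_k.+1 -> X11 -> X01) (v : 'I_l.+1 -> X01 -> X) (E : prebundle R X)
    (e : section E) p :
  (forall i j z, h i (v' j z) = v j (h' i z)) ->
  coord (delta_sec h' (delta_sec v e)) (delta_swap v' h h' v E p) =
  coord (delta_sec v' (delta_sec h e)) p.
Proof. by move=> hv; apply: coord_bmap => z; exact: delta_swapE. Qed.

Lemma coord_delta_one X'' X' X k (d' : 'I_k.+2 -> X'' -> X')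
    (d : 'I_k.+1 -> X' -> X) (E : prebundle R X) (e : section E) z :
  simplicial_id d d' ->
  coord (delta_sec d' (delta_sec d e)) (delta_one d' d E z) = u1_one.
Proof. by move=> dd'; rewrite -(delta_oneE e dd') coord_sec. Qed.
End Coordinates.

(** * The circle group *)

Section Circle.
Context {R : realType}.

Lemma u1_val_continuous : continuous (@u1_val R : U1 R -> R[i]^o).
Proof. exact: set_val_continuous. Qed.

Lemma u1_hausdorff : hausdorff_space (U1 R).
Proof.
apply: (@hausdorff_inj _ (R[i]^o) (@u1_val R)).
- exact: u1_val_continuous.
- exact: u1_inj.
- exact: norm_hausdorff.
Qed.

Variable S : topologicalType.
Implicit Types u v : S -> U1 R.

Lemma ncont_u1_mul u v x : ncont u x -> ncont v x ->
  ncont (fun y => u1_mul (u y) (v y)) x.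
Proof.
move=> cu cv; apply: ncont_set_type; apply: filterS2 cu cv => y cu cv.
have cu' := continuous_comp cu (@u1_val_continuous (u y)).
have cv' := continuous_comp cv (@u1_val_continuous (v y)).
exact: (cvgM cu' cv').
Qed.

Lemma ncont_u1_inv u x : ncont u x -> ncont (fun y => u1_inv (u y)) x.
Proof.
move=> cu; apply: ncont_set_type; apply: filterS cu => y cu.
have cu' := continuous_comp cu (@u1_val_continuous (u y)).
by apply: (cvgV _ cu'); exact: u1_neq0.
Qed.
End Circle.

(** * Local charts of bundles *)

Section Charts.
Context {R : realType}.
Implicit Types X S : topologicalType.

(** The coordinate is required to be continuous at all points of the fibre, so
    that the domain of a chart is saturated in the total space; this is needed to
    descend to the quotient that defines a tensor product. *)
Definition charted X (P : prebundle R X) (s : section P) (x : X) : Prop :=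
  {for x, continuous s} /\
  forall p, prj P p = x -> {for p, continuous (coord s)}.

Definition chart X (P : prebundle R X) (s : section P) (x : X) : Prop :=
  nbhs x (charted s).

Lemma chart_ncont X (P : prebundle R X) (s : section P) x :
  chart s x -> ncont s x.
Proof. by apply: filterS => y []. Qed.

Lemma chart_coord X (P : prebundle R X) (s : section P) p :
  continuous (prj P) -> chart s (prj P p) -> ncont (coord s) p.
Proof.
move=> cP /(near_comp (cP p)); apply: filterS => q [_]; exact.
Qed.

Lemma chart_ext X (P : prebundle R X) (s t : section P) x :
  continuous (prj P) -> nbhs x [set y | s y = t y] -> chart s x -> chart t x.
Proof.
move=> cP /near_near e cs; apply: filterS2 e cs => y e [cs cc]; split.
  exact: (continuous_at_ext (f := s) (g := t) e cs).
move=> p py; apply: continuous_at_ext (cc p py).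
have : nbhs p [set q | s (prj P q) = t (prj P q)].
  by apply: (near_comp (P := [set y | s y = t y]) (cP p)); rewrite py.
apply: filterS => q eq; apply: coord_unique.
by rewrite eq -coordP.
Qed.

(** The operators on sections take sections defined everywhere, so local sections
    are completed by arbitrary values. *)
Lemma extend_section X (P : prebundle R X) (U : set X) (s : X -> P)
    (t : section P) : {in U, cancel s (prj P)} ->
  exists s' : section P, (forall x, U x -> s' x = s x) /\
    forall x, ~ U x -> s' x = t x.
Proof.
move=> sK; pose f x := if pselect (U x) then s x else t x.
have fK : cancel f (prj P).
  move=> x; rewrite /f; case: pselect => [Ux|_] /=; last exact: secK.
  exact: (sK x (mem_set Ux)).
by exists (Section fK); split=> x /=; rewrite /f; case: pselect.
Qed.

Lemma principal_chart X (P : prebundle R X) x : principal P ->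
  exists s : section P, chart s x.
Proof.
move=> hP; have [U [s [c [[oU Ux cs sK] [cc pE _]]]]] := loc_triv hP x.
have [s' [s'E _]] := extend_section (some_section P) sK; exists s'.
move: cs cc; rewrite continuous_open_subspace // => cs.
have oPU : open (prj P @^-1` U).
  by move: U oU {Ux cs sK pE s'E}; apply/continuousP; exact: prj_continuous.
rewrite continuous_open_subspace // => cc.
have nU y : U y -> nbhs y U by move=> Uy; exact: open_nbhs_nbhs.
rewrite /chart; apply: filterS (nU x Ux) => y Uy; split.
  apply: continuous_at_ext (cs y (mem_set Uy)).
  by apply: filterS (nU y Uy) => z /s'E ->.
move=> p py; have Up : (prj P @^-1` U) p by rewrite /= py.
apply: continuous_at_ext (cc p (mem_set Up)).
apply: filterS (open_nbhs_nbhs (conj oPU Up)) => q Uq.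
by apply/esym/coord_unique; rewrite s'E // -pE.
Qed.

Lemma chart_loc_triv X (P : prebundle R X) (s : section P) x :
  continuous (prj P) -> chart s x ->
  exists (U : set X) (s : X -> P) (c : P -> U1 R),
    [/\ open U, U x, {within U, continuous s} & {in U, cancel s (prj P)}] /\
    [/\ {within prj P @^-1` U, continuous c},
        forall p, U (prj P p) -> p = uact (c p) (s (prj P p)) &
        forall u p, U (prj P p) -> c (uact u p) = u1_mul u (c p)].
Proof.
move=> cP; rewrite /chart nbhsE => -[U [oU Ux] hU]; exists U, s, (coord s).
have oPU : open (prj P @^-1` U).
  by move: U oU {Ux hU}; apply/continuousP.
split; split=> //.
- rewrite continuous_open_subspace // => y; rewrite inE => Uy.
  exact: (hU y Uy).1.
- by move=> y _; exact: secK.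
- rewrite continuous_open_subspace // => p; rewrite inE => Up.
  exact: (hU _ Up).2.
- by move=> p _; exact: coordP.
- by move=> u p _; exact: coord_act.
Qed.

(** By the Hausdorff property, charts around finitely many points extend to a
    common section.  All face maps of an iterated [delta] can therefore be
    handled with a single section of the bundle. *)
Lemma common_chart X (P : prebundle R X) (l : seq X) :
  hausdorff_space X -> principal P ->
  exists s : section P, forall x, x \in l -> chart s x.
Proof.
move=> hX hP; have cP := prj_continuous hP.
elim: l => [|x l [s hs]]; first by exists (some_section P).
have [xl|xl] := boolP (x \in l).
  by exists s => y; rewrite inE => /orP[/eqP ->|]; exact: hs.
(* separate [x] from the remaining points *)
have [V [oV Vx Vl]] : exists V, [/\ open V, V x &
    forall y, y \in l -> nbhs y (~` V)].
  elim: l xl {hs} => [|y l IH].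
    by move=> _; exists setT; split=> //; exact: openT.
  rewrite inE negb_or => /andP[xy /IH[V [oV Vx Vl]]].
  have := hX; rewrite open_hausdorff => /(_ _ _ xy)[[A B]] /=.
  rewrite !inE => -[Ax By] [oA oB AB].
  exists (V `&` A); split=> //; first exact: openI.
  move=> z; rewrite inE => /orP[/eqP ->|/Vl].
    apply: filterS (open_nbhs_nbhs (conj oB By)) => w Bw [_ Aw].
    by have : (A `&` B) w by []; rewrite AB.
  by apply: filterS => w nV [].
have [t ct] := principal_chart x hP.
have [s' [s'V s'nV]] := extend_section s (fun y (_ : y \in V) => secK t y).
exists s' => y; rewrite inE => /orP[/eqP ->|yl].
  apply: chart_ext ct => //.
  by apply: filterS (open_nbhs_nbhs (conj oV Vx)) => z /s'V.
by apply: chart_ext (hs y yl) => //; apply: filterS (Vl y yl) => z /s'nV.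
Qed.

(** Points of different fibres are separated in the base, points of one fibre by
    the coordinate of a chart. *)
Lemma hausdorff_charts X (P : prebundle R X) :
  hausdorff_space X -> continuous (prj P) ->
  (forall x, exists s : section P, chart s x) -> hausdorff_space P.
Proof.
move=> hX cP hs p q cl.
have epq : prj P p = prj P q.
  apply: hX => A B nA nB.
  by have [r [Ar Br]] := cl _ _ (cP p _ nA) (cP q _ nB); exists (prj P r).
have [s cs] := hs (prj P p).
apply: (coord_inj (s := s)) => //; apply: u1_hausdorff => A B nA nB.
have cp := ncont_at (chart_coord cP cs).
have cq : {for q, continuous (coord s)}.
  by apply/ncont_at/chart_coord => //; rewrite -epq.
by have [r [Ar Br]] := cl _ _ (cp _ nA) (cq _ nB); exists (coord s r).
Qed.

Lemma ncont_uact X (P : prebundle R X) S (u : S -> U1 R) (p : S -> P) x :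
  cgh S -> principal P -> ncont u x -> ncont p x ->
  ncont (fun y => uact (u y) (p y)) x.
Proof.
move=> cS hP cu cp.
have c : ncont (fun y => (u y, p y) : kspace (U1 R * P)%type) x.
  by apply: ncont_kspace => //; exact: ncont_pair.
exact: (ncont_comp c (continuous_ncont _ (uact_continuous hP))).
Qed.

Lemma principal_cover X (P : prebundle R X) : cgh X -> principal P ->
  is_cover (prj P).
Proof.
move=> cX hP; apply: coverI => //.
- exact: principal_cgh.
- exact: prj_continuous.
move=> x; have [s cs] := principal_chart x hP.
exists s; split; first exact: chart_ncont.
by apply: filterE => y; exact: secK.
Qed.

(** ** Pullback *)

Section Pull.
Variables (X' X : topologicalType) (f : X' -> X) (P : prebundle R X).
Hypotheses (cX' : cgh X') (cf : continuous f) (hP : principal P).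

Lemma chart_pull (s : section P) x : chart s (f x) -> chart (pull_sec f s) x.
Proof.
move=> cs; have cps : ncont (pull_sec f s) x.
  apply: ncont_fibprod => //.
    by apply: continuous_ncont => y; exact: cvg_id.
  exact: (ncont_comp (continuous_ncont _ cf) (chart_ncont cs)).
have cfs : nbhs x (f @^-1` charted s) := near_comp (@cf x) cs.
apply: filterS2 cps cfs => y cy [_ cc]; split=> // p py.
have -> : coord (pull_sec f s) = coord s \o (@fib2 _ _ _ _ _).
  by apply: funext => q; exact: coord_pull.
apply: continuous_comp; first exact: fib2_continuous.
by apply: cc; rewrite -fib_eq -py.
Qed.

Lemma principal_pull : principal (pull f P).
Proof.
have cP := principal_cgh hP; have cp : continuous (prj (pull f P)).
  exact: fib1_continuous.
have cpull : cgh (pull f P) by apply: cgh_fibprod; [exact: cX'.1 | exact: cP.1].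
split=> //.
  have hS : cgh (kspace (U1 R * pull f P)%type).
    by apply/cgh_kspace/hausdorff_prod; [exact: u1_hausdorff | exact: cpull.1].
  apply: continuous_fibprod => // up.
    exact: (continuous_comp (@kspace_snd_continuous _ _ up)
                            (@fib1_continuous _ _ _ _ _ _)).
  apply/ncont_at/ncont_uact => //; apply: continuous_ncont => {}up.
    exact: kspace_fst_continuous.
  exact: (continuous_comp (@kspace_snd_continuous _ _ up)
                          (@fib2_continuous _ _ _ _ _ _)).
move=> x; have [s cs] := principal_chart (f x) hP.
exact: (chart_loc_triv cp (chart_pull cs)).
Qed.
End Pull.

(** ** Dual *)

Section Dual.
Variables (X : topologicalType) (P : prebundle R X).
Hypothesis hP : principal P.

Lemma chart_dual (s : section P) x : chart s x -> chart (dual_sec s) x.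
Proof.
move=> /near_near; apply: filterS => y cs; split.
  exact: (nbhs_singleton cs).1.
move=> p py; have cc : ncont (coord s) p.
  by apply: (chart_coord (prj_continuous hP)); rewrite [prj P p]py.
have -> : coord (dual_sec s) = fun p : dual P => u1_inv (coord s p).
  by apply: funext => q; exact: coord_dual.
exact: (ncont_at (ncont_u1_inv cc)).
Qed.

Lemma principal_dual : principal (dual P).
Proof.
split; [exact: (principal_cgh hP) | exact: (prj_continuous hP) | |].
  have hS : cgh (kspace (U1 R * P)%type).
    apply/cgh_kspace/hausdorff_prod; first exact: u1_hausdorff.
    exact: (principal_cgh hP).1.
  have c1 : continuous (fst : kspace (U1 R * P)%type -> U1 R).
    exact: kspace_fst_continuous.
  have c2 : continuous (snd : kspace (U1 R * P)%type -> P).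
    exact: kspace_snd_continuous.
  apply: ncont_continuous => up; apply: (ncont_uact (P := P)) => //.
    exact: (ncont_u1_inv (continuous_ncont _ c1)).
  exact: continuous_ncont.
move=> x; have [s cs] := principal_chart x hP.
exact: (chart_loc_triv (prj_continuous hP : continuous (prj (dual P)))
  (chart_dual cs)).
Qed.
End Dual.
End Charts.

(** ** Tensor product *)

Section TensorTop.
Context {R : realType} {X : topologicalType}.
Variables P Q : prebundle R X.
Let D : topologicalType := fibprod (prj P) (prj Q).

Definition tens_pi (d : D) : tensor P Q := tpure (fib_eq d).

Lemma tens_piE : tens_pi = \pi_({eq_quot (tens_equiv P Q)}).
Proof.
by apply: funext => d; rewrite /tens_pi /tpure; congr (\pi _); apply: fibprod_inj.
Qed.

Lemma tens_pi_continuous : continuous tens_pi.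
Proof. by rewrite tens_piE; exact: pi_continuous. Qed.

Lemma tens_open (O : set (tensor P Q)) : open (tens_pi @^-1` O) -> open O.
Proof. by rewrite tens_piE. Qed.

Lemma tens_prj_continuous : continuous (prj P) -> continuous (prj (tensor P Q)).
Proof.
move=> cP; apply/continuousP => O oO; apply: tens_open.
have -> : tens_pi @^-1` (prj (tensor P Q) @^-1` O) =
    (prj P \o @fib1 _ _ _ _ _) @^-1` O.
  by apply: funext => d; rewrite /preimage /mkset prj_tpure.
move: O oO; apply/continuousP => d.
exact: (continuous_comp (@fib1_continuous _ _ _ _ _ _) (cP _)).
Qed.

(** The preimage in [P x_X Q] of an open set of [X] is open and saturated, so
    continuity over it descends to the quotient. *)
Lemma tens_continuous_at (Z : topologicalType) (f : tensor P Q -> Z) (O : set X) :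
  continuous (prj P) -> open O ->
  (forall d, O (prj P (fib1 d)) -> {for d, continuous (f \o tens_pi)}) ->
  forall t, O (prj (tensor P Q) t) -> {for t, continuous f}.
Proof.
move=> cP oO cf t Ot; set A := prj (tensor P Q) @^-1` O.
have oA : open A by move/continuousP: (tens_prj_continuous cP); apply.
suff : {in A, continuous f} by apply; rewrite inE.
apply/(continuous_inP f oA) => V oV; apply: tens_open.
have -> : tens_pi @^-1` (A `&` f @^-1` V) =
    (tens_pi @^-1` A) `&` (f \o tens_pi) @^-1` V by [].
have opA : open (tens_pi @^-1` A).
  by move/continuousP: tens_pi_continuous; apply.
move: V oV; apply/(continuous_inP (f \o tens_pi) opA) => d; rewrite inE => Ad.
by apply: cf; move: Ad; rewrite /A /preimage /mkset prj_tpure.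
Qed.

Hypotheses (cX : cgh X) (hP : principal P) (hQ : principal Q).

Lemma chart_tens (s : section P) (t : section Q) x :
  chart s x -> chart t x -> chart (tens_sec s t) x.
Proof.
move=> cs ct.
have cst : ncont (tens_sec s t) x.
  pose h y : D := fpair (tens_sec_subproof s t y).
  have ch : ncont h x.
    by apply: ncont_fibprod => //; exact: chart_ncont.
  apply: ncont_ext (ncont_comp ch (continuous_ncont _ tens_pi_continuous)).
  apply: filterE => y /=; rewrite /tens_pi.
  by apply: (tpure_eq _ _ (u := u1_one)); rewrite ?u1_inv1 uact1.
have : nbhs x (charted s `&` charted t) by exact: filterI.
rewrite nbhsE => -[O [oO Ox] cO].
apply: filterS2 cst (open_nbhs_nbhs (conj oO Ox)) => y cy Oy; split=> // p py.
apply: (tens_continuous_at (prj_continuous hP) oO) => [d Od|]; last by rewrite py.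
have nO : nbhs (prj P (fib1 d)) O by exact: open_nbhs_nbhs.
have E : coord (tens_sec s t) \o tens_pi =
    fun d : D => u1_mul (coord s (fib1 d)) (coord t (fib2 d)).
  by apply: funext => q; exact: coord_tens.
rewrite E; apply/ncont_at/ncont_u1_mul.
  apply: (ncont_comp (f := @fib1 _ _ _ _ _)).
    exact: (continuous_ncont _ (@fib1_continuous _ _ _ _ _)).
  apply: (chart_coord (prj_continuous hP)).
  by apply: filterS nO => z /cO[].
apply: (ncont_comp (f := @fib2 _ _ _ _ _)).
  exact: (continuous_ncont _ (@fib2_continuous _ _ _ _ _)).
apply: (chart_coord (prj_continuous hQ)); rewrite -fib_eq.
by apply: filterS nO => z /cO[].
Qed.

(** The charts are the products of charts; the action is continuous because in a
    chart it comes from the action on the first factor of [P x_X Q]. *)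
Lemma principal_tens : principal (tensor P Q).
Proof.
have cp := tens_prj_continuous (prj_continuous hP).
have cht x : exists s : section (tensor P Q), chart s x.
  have [s cs] := principal_chart x hP; have [t ct] := principal_chart x hQ.
  by exists (tens_sec s t); exact: chart_tens.
have cD : cgh D.
  by apply: cgh_fibprod; [exact: (principal_cgh hP).1|exact: (principal_cgh hQ).1].
have cT : cgh (tensor P Q).
  split; first exact: (hausdorff_charts cX.1 cp cht).
  by move=> O kO; apply/tens_open/cD.2; exact: (kopen_preimage tens_pi_continuous kO).
have cS : cgh (kspace (U1 R * tensor P Q)%type).
  by apply/cgh_kspace/hausdorff_prod; [exact: u1_hausdorff | exact: cT.1].
split=> //; last first.
  by move=> x; have [s cs] := cht x; exact: (chart_loc_triv cp cs).
apply: ncont_continuous => ut.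
have c1 : ncont (fst : kspace (U1 R * tensor P Q)%type -> U1 R) ut.
  exact: (continuous_ncont _ (@kspace_fst_continuous _ _)).
have c2 : ncont (snd : kspace (U1 R * tensor P Q)%type -> tensor P Q) ut.
  exact: (continuous_ncont _ (@kspace_snd_continuous _ _)).
have c3 := ncont_comp c2 (continuous_ncont _ cp).
have [s cs] := principal_chart (prj _ ut.2) hP.
have [t ct] := principal_chart (prj _ ut.2) hQ.
(* [u . t] is the class of [(w . s, t)] over the base point of [t] *)
pose w (vt : kspace (U1 R * tensor P Q)%type) :=
  u1_mul vt.1 (coord (tens_sec s t) vt.2).
have cw : ncont w ut.
  apply: ncont_u1_mul => //.
  exact: (ncont_comp c2 (chart_coord cp (chart_tens cs ct))).
have e (vt : kspace (U1 R * tensor P Q)%type) :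
    prj P (uact (w vt) (s (prj _ vt.2))) = prj Q (t (prj _ vt.2)).
  by rewrite prj_act !secK.
pose h vt : D := fpair (e vt).
have ch : ncont h ut.
  apply: ncont_fibprod => //.
    by apply: ncont_uact => //; exact: (ncont_comp c3 (chart_ncont cs)).
  exact: (ncont_comp c3 (chart_ncont ct)).
apply: ncont_ext (ncont_comp ch (continuous_ncont _ tens_pi_continuous)).
apply: filterE => vt.
transitivity (uact (w vt) (tens_sec s t (prj _ vt.2))).
  rewrite [RHS](uact_tpure (tens_sec_subproof s t _) (e vt)).
  by apply: (tpure_eq _ _ (u := u1_one)); rewrite ?u1_inv1 uact1.
by rewrite /w -uactM -coordP.
Qed.
End TensorTop.

(** ** Iterated [delta] *)

Section DeltaTop.
Context {R : realType}.
Variables (X' X : topologicalType) (P : prebundle R X).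
Hypotheses (cX' : cgh X') (hP : principal P).

Lemma principal_signed b (Y : topologicalType) (Q : prebundle R Y) :
  principal Q -> principal (signed b Q).
Proof. by case: b => // hQ; exact: principal_dual. Qed.

Lemma chart_signed b (Y : topologicalType) (Q : prebundle R Y) (s : section Q) y :
  principal Q -> chart s y -> chart (signed_sec b s) y.
Proof. by case: b => // hQ; exact: chart_dual. Qed.

Lemma principal_delta k (d : 'I_k.+1 -> X' -> X) :
  (forall i, continuous (d i)) -> principal (delta d P).
Proof.
rewrite /delta; move: true => b; elim: k b d => [|k IH] b d cd /=.
  by apply: principal_signed => //; exact: principal_pull.
apply: principal_tens => //; last by apply: IH => i; exact: cd.
by apply: principal_signed => //; exact: principal_pull.
Qed.

Lemma chart_delta k (d : 'I_k.+1 -> X' -> X) (s : section P) z :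
  (forall i, continuous (d i)) -> (forall i, chart s (d i z)) ->
  chart (delta_sec d s) z.
Proof.
rewrite /delta_sec /delta => cd cs.
suff : forall b, principal (delta_from b d P) /\ chart (delta_from_sec b d s) z.
  by move=> /(_ true)[].
elim: k d cd cs => [|k IH] d cd cs b /=.
  split; first by apply: principal_signed => //; exact: principal_pull.
  by apply: chart_signed; [exact: principal_pull | exact: chart_pull].
have [pd ctl] := IH _ (fun i => cd (lift ord0 i)) (fun i => cs (lift ord0 i)) (~~ b).
have phd : principal (signed b (pull (d ord0) P)).
  by apply: principal_signed => //; exact: principal_pull.
split; first exact: principal_tens.
apply: chart_tens => //.
by apply: chart_signed; [exact: principal_pull | exact: chart_pull].
Qed.

Lemma ncont_delta_fun k b (d : 'I_k.+1 -> X' -> X) (u : X -> U1 R) z :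
  (forall i, continuous (d i)) -> (forall i, ncont u (d i z)) ->
  ncont (delta_fun b d u) z.
Proof.
elim: k b d => [|k IH] b d cd cu.
  have c := ncont_comp (continuous_ncont z (cd ord0)) (cu ord0).
  by case: b => //; exact: ncont_u1_inv.
have c := ncont_comp (continuous_ncont z (cd ord0)) (cu ord0).
apply: ncont_u1_mul; first by case: b => //; exact: ncont_u1_inv.
by apply: IH => i; [exact: cd | exact: cu].
Qed.

(** A chart of [P] that serves all the points [d i z] at once. *)
Lemma delta_chart k (d : 'I_k.+1 -> X' -> X) z : hausdorff_space X ->
  (forall i, continuous (d i)) ->
  exists s : section P, (forall i, chart s (d i z)) /\ chart (delta_sec d s) z.
Proof.
move=> hX cd.
have [s cs] := common_chart (map (d^~ z) (enum 'I_k.+1)) hX hP.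
have csd i : chart s (d i z) by apply/cs/map_f; rewrite mem_enum.
by exists s; split=> //; exact: chart_delta.
Qed.
End DeltaTop.

(** ** Continuity of bundle maps *)

Section BundleMaps.
Context {R : realType}.
Implicit Types X : topologicalType.

Lemma bmap_continuous X X' (g : X -> X') (P : prebundle R X) (P' : prebundle R X')
    (F : bmap g P P') : principal P -> principal P' ->
  (forall x, exists2 s : section P, chart s x & ncont (F \o s) x) -> continuous F.
Proof.
move=> hP hP' h; apply: ncont_continuous => p.
have [s cs cFs] := h (prj P p); have cp := prj_continuous hP.
have c : ncont (fun q => uact (coord s q) ((F \o s) (prj P q))) p.
  apply: ncont_uact => //; first exact: principal_cgh.
    exact: chart_coord.
  exact: (ncont_comp (continuous_ncont _ cp) cFs).
apply: ncont_ext c; apply: filterE => q /=.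
by rewrite -bmap_act -coordP.
Qed.

(** In charts, [F] multiplies by a continuous U(1)-valued function, and the inverse
    map multiplies by its inverse. *)
Lemma bmap_bundle_iso X (P Q : prebundle R X) (F : bmap id P Q) :
  cgh X -> principal P -> principal Q -> continuous F -> bundle_iso F.
Proof.
move=> cX hP hQ cF; split=> //; pose G := lift_bmap F (bmap_id Q).
have FG q : F (G q) = q by exact: lift_ptK.
have GF p : G (F p) = p.
  by apply: (bmap_inj (F := F)); rewrite ?FG // !bmap_proj.
exists G => //; apply: bmap_continuous => // x.
have [s cs] := principal_chart x hP; have [t ct] := principal_chart x hQ.
exists t => //.
have c : ncont (fun y => uact (u1_inv (coord t (F (s y)))) (s y)) x.
  apply: ncont_uact => //; last exact: chart_ncont.
  apply/ncont_u1_inv/(ncont_comp (f := F \o s)).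
    exact: (ncont_comp (chart_ncont cs) (continuous_ncont _ cF)).
  by apply: (chart_coord (prj_continuous hQ)); rewrite /= bmap_proj secK.
apply: ncont_ext c; apply: filterE => y; rewrite -[RHS]/(G (t y)).
apply: (bmap_inj (F := F)); first by rewrite prj_act secK bmap_proj secK.
rewrite FG bmap_act {2}(coordP t (F (s y))) uactM bmap_proj secK.
by rewrite u1_mulC u1_mulV uact1.
Qed.

(** The lifted section has the coordinates of [t], by [coord_lift_sec]. *)
Lemma lift_sec_continuous X X' (g : X -> X') (P : prebundle R X)
    (P' : prebundle R X') (F : bmap g P P') (t : section P') :
  cgh X -> continuous g -> principal P -> principal P' ->
  (forall x, exists (s : section P) (s' : section P'),
    [/\ chart s x, chart s' (g x) & forall y, F (s y) = s' (g y)]) ->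
  continuous t -> continuous (lift_sec F t).
Proof.
move=> cX cg hP hP' h ct; apply: ncont_continuous => x.
have [s [s' [cs cs' Fs]]] := h x.
have c : ncont (fun y => uact (coord s' (t (g y))) (s y)) x.
  apply: ncont_uact => //; last exact: chart_ncont.
  apply: (ncont_comp (f := t \o g)).
    exact: (ncont_comp (continuous_ncont _ cg) (continuous_ncont _ ct)).
  by apply: (chart_coord (prj_continuous hP')); rewrite /= secK.
apply: ncont_ext c; apply: filterE => y.
by rewrite -(coord_lift_sec t y Fs) -sec_coord.
Qed.

(** For a chart [s] of [P], the sections [delta] of [s] and of its pullback are
    charts that correspond to each other. *)
Lemma lift_delta_continuous (A A' : topologicalType) X X' k (h : A -> A')
    (g : X -> X') (d : 'I_k.+1 -> A -> X) (d' : 'I_k.+1 -> A' -> X')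
    (e : forall i a, d' i (h a) = g (d i a)) (P : prebundle R X')
    (t : section (delta d' P)) :
  cgh A -> cgh A' -> cgh X -> cgh X' -> continuous h -> continuous g ->
  (forall i, continuous (d i)) -> (forall i, continuous (d' i)) ->
  principal P -> continuous t ->
  continuous (lift_sec (bmap_delta e (pull_pr g P)) t).
Proof.
move=> cA cA' cX cX' ch cg cd cd' hP ct.
have hgP := principal_pull cX cg hP.
apply: lift_sec_continuous => //; try exact: principal_delta.
move=> a; have [s [cs cds]] := delta_chart cA' hP (h a) cX'.1 cd'.
exists (delta_sec d (pull_sec g s)), (delta_sec d' s); split=> //.
  apply: chart_delta => // i; apply: chart_pull => //.
  by rewrite -e.
by move=> b; apply: bmap_delta_sec.
Qed.
End BundleMaps.

(** * The semisimplicial space of a bigerbe *)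

Section BiSquareCover.
Variables (X : topologicalType) (Q : bisquare X).
Hypotheses (cw1 : is_cover (@bw1 X Q)) (cy1 : is_cover (@by1 X Q)).
Hypotheses (cy2 : is_cover (@by2 X Q)) (cW12 : is_cover (@bW12 X Q)).

Let cW : cgh (bW Q). Proof. by case: cw1. Qed.
Let cY1 : cgh (bY1 Q). Proof. by case: cy1. Qed.

(** A local section of [Y_2 -> X] gives a common second coordinate, so that the
    points of [Y_1] can be lifted to [W] along [W -> Y_1 x_X Y_2] in a single
    fibre of [W -> Y_2]. *)
Lemma bsq_pi_cover k : is_cover (@bsq_pi X Q k.+1).
Proof.
have cP : cgh (fibpow (@by1 X Q) k.+1) by exact: (cgh_fibpow _ _ cY1.1).
apply: coverI => //; first exact: (cgh_fibpow _ _ cW.1).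
  by apply: fpmap_continuous; [exact: cW.1 | case: cw1].
move=> a; pose base (y : fibpow (@by1 X Q) k.+1) := by1 (fpev y ord0).
have cbase : continuous base.
  move=> y; apply: continuous_comp; first exact: fpev_continuous.
  by case: cy1 => _ _ c _; exact: c.
have [s [cs sK]] := cover_section (base a) cy2.
have cb := ncont_comp (continuous_ncont a cbase) cs.
have sbase := near_comp (@cbase a) sK.
have lift_i i : exists w : fibpow (@by1 X Q) k.+1 -> bW Q, ncont w a /\
    \forall y \near a, bw1 (w y) = fpev y i /\ bw2 (w y) = s (base y).
  have [h [ch h1 h2]] : exists h : fibpow (@by1 X Q) k.+1 ->
      fibprod (@by1 X Q) (@by2 X Q), [/\ ncont h a,
      (\forall y \near a, fib1 (h y) = fpev y i) &
      (\forall y \near a, fib2 (h y) = (s \o base) y)].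
    apply: local_fpair => //; first exact: (continuous_ncont _ (@fpev_continuous _ _ _ _ _)).
    by apply: filterS sbase => y /= ->; exact: fpev_eq.
  have [t [ct tK]] := cover_section (h a) cW12.
  exists (t \o h); split; first exact: ncont_comp.
  have th := near_comp (ncont_at ch) tK.
  near=> y.
  have ty : bW12 (t (h y)) = h y by near: y.
  have h1y : fib1 (h y) = fpev y i by near: y.
  have h2y : fib2 (h y) = s (base y) by near: y.
  by split; [rewrite -h1y -ty | rewrite -h2y -ty].
have {lift_i}/choice[w wP] := lift_i.
have wE : \forall y \near a, forall i,
    bw1 (w i y) = fpev y i /\ bw2 (w i y) = s (base y).
  apply: (filter_forall (F := nbhs a) (f := fun i y =>
    bw1 (w i y) = fpev y i /\ bw2 (w i y) = s (base y))) => i.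
  exact: (wP i).2.
have [||h [ch hE]] := @local_fptup _ _ (@bw2 X Q) k.+1 _ w a cP.
- by move=> i; exact: (wP i).1.
- by apply: filterS wE => y wE i j; rewrite (wE i).2 (wE j).2.
exists h; split=> //; apply: filterS2 hE wE => y hE wE.
by apply: fibpow_inj => i; rewrite -(wE i).1 -hE.
Unshelve. all: by end_near. Qed.

Lemma bsq_ss_cover : is_ss_cover (bsq_over Q).
Proof.
split; last 3 first; try exact: bsq_pi_cover.
- exact: bsq_simplicial.
- exact: fpface1_continuous.
- by move=> i; apply: fpface_continuous; exact: cW.1.
- by move=> i; apply: fpface_continuous; exact: cW.1.
- exact: cw1.
Qed.
End BiSquareCover.

(** * The semisimplicial space [N(L)] *)

Section CircleIdentities.
Context {R : realType}.
Implicit Types a b c p r m n u : U1 R.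

Lemma u1_cocycle a b c p r m n :
  u1_mul (u1_mul a (u1_mul (u1_inv p) b))
    (u1_mul (u1_mul (u1_inv a) (u1_mul n (u1_inv r)))
       (u1_mul (u1_mul p (u1_mul (u1_inv m) c))
          (u1_mul (u1_inv b) (u1_mul r (u1_inv c))))) = u1_one ->
  m = n.
Proof.
move/(congr1 (@u1_val R)); rewrite !(u1_valM, u1_valV) => e.
apply/esym/u1_inj; transitivity (u1_val m * u1_val (@u1_one R)).
  by rewrite -e; field; rewrite !u1_neq0.
exact: mulr1.
Qed.

Lemma u1_mul_solve a b m : m = u1_mul (u1_mul a b)
  (u1_inv (u1_mul a (u1_mul (u1_inv m) b))).
Proof.
apply: u1_inj; rewrite !(u1_valM, u1_valV).
by field; rewrite !u1_neq0.
Qed.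
End CircleIdentities.

Section NerveTheory.
Context {R : realType} {Y X : topologicalType} {y : Y -> X}.
Variables (S : ss_over y) (hS : simplicial S).
Variables (L : prebundle R (ss1 S)) (s : section (delta (sd2 S) L)).

(** The defining equation of the multiplication: in coordinates, [s] is the
    alternating product over the faces of a 2-simplex of [N(L)]. *)
Lemma coord_nerve_mul (q : section L) (x : nerve2 L) :
  coord (delta_sec (sd2 S) q) (s (nerve2_base x)) =
  delta_fun true (@nerve_sd2 _ _ _ _ S L s) (coord q) x.
Proof.
rewrite /= /nerve_sd2 /= /nerve_mul; case: (nerve_mul_subproof s x) => c [e es] /=.
by rewrite es /delta_sec /= !coord_tens coord_dual !coord_pull.
Qed.

Section Assoc.
Hypothesis s_one : delta_sec (sd3 S) s =1 delta_one (sd3 S) (sd2 S) L.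

(** Applying [coord_nerve_mul] to the four faces of a 3-simplex turns the cocycle
    condition on [s] into an identity in which the edges cancel and only the two
    bracketings of the triple product remain. *)
Lemma nerve_mulA (x : nerve3 L) :
  nerve_mul s (nerve3_d2 hS s x) = nerve_mul s (nerve3_d1 hS s x).
Proof.
pose q := some_section L.
apply: (coord_inj (s := q)).
  rewrite -!nerve_mul_proj; apply: hS.2 => //.
have := congr1 (coord (delta_sec (sd3 S) (delta_sec (sd2 S) q)))
  (s_one (nerve3_base x)).
rewrite coord_delta_one; last exact: hS.2.
rewrite coord_delta_sec /=.
have E i : coord (delta_sec (sd2 S) q) (s (sd3 S i (nerve3_base x))) =
    delta_fun true (@nerve_sd2 _ _ _ _ S L s) (coord q) (nerve_sd3 hS s i x).
  by rewrite -coord_nerve_mul nerve_sd3_base.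
rewrite !E /nerve_sd2 /nerve_sd3 /=.
rewrite !u1_invM !u1_invK; exact: u1_cocycle.
Qed.

Lemma nerve_simplicial : simplicial (nerve hS s).
Proof.
split=> [i j1 i' j ij ei ej x|i j1 i' j ij ei ej x].
  by rewrite /= /nerve_sd1 !nerve_sd2_proj; exact: hS.1.
(* only [d_1 d_2 = d_1 d_1] involves a product of three edges *)
case: i ij ei => [[|[|[|//]]] hi]; case: j ej => [[|[|[|[|//]]]] hj] //= ej _;
  case: j1 ej => [[|[|[|//]]] hj1] // _; case: i' => [[|[|[|[|//]]]] hi'] // _.
all: try by [].
all: exact: nerve_mulA.
Qed.
End Assoc.

Hypotheses (cS : is_ss_cover S) (hL : principal L) (cs : continuous s).

Let c1 : cgh (ss1 S). Proof. by case: (pi1_cover cS). Qed.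
Let c2 : cgh (ss2 S). Proof. by case: (pi2_cover cS). Qed.
Let c3 : cgh (ss3 S). Proof. by case: (pi3_cover cS). Qed.
Let cL : cgh L := principal_cgh hL.

Let cpull2 i : cgh (pull (sd2 S i) L).
Proof. by apply: cgh_fibprod; [exact: c2.1 | exact: cL.1]. Qed.

Lemma cgh_nerve2 : cgh (nerve2 L).
Proof. by apply: cgh_fibprod; [exact: (cpull2 _).1 | exact: (cpull2 _).1]. Qed.

Lemma cgh_nerve3 : cgh (nerve3 L).
Proof.
have cp (e : ss3 S -> ss1 S) : cgh (pull e L).
  by apply: cgh_fibprod; [exact: c3.1 | exact: cL.1].
apply: cgh_fibprod; first exact: (cp _).1.
by apply: (cgh_fibprod _ _ _ _).1; exact: (cp _).1.
Qed.

Lemma nerve2_base_continuous : continuous (@nerve2_base _ _ _ _ S L).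
Proof.
move=> x; exact: (continuous_comp (@fib1_continuous _ _ _ _ _ x)
                                  (@fib1_continuous _ _ _ _ _ _)).
Qed.

Lemma nerve3_base_continuous : continuous (@nerve3_base _ _ _ _ S L).
Proof.
move=> x; exact: (continuous_comp (@fib1_continuous _ _ _ _ _ x)
                                  (@fib1_continuous _ _ _ _ _ _)).
Qed.

Lemma nerve2_fst_continuous : continuous (fun x : nerve2 L => fib2 (fib1 x)).
Proof.
move=> x; exact: (continuous_comp (@fib1_continuous _ _ _ _ _ x)
                                  (@fib2_continuous _ _ _ _ _ _)).
Qed.

Lemma nerve2_snd_continuous : continuous (fun x : nerve2 L => fib2 (fib2 x)).
Proof.
move=> x; exact: (continuous_comp (@fib2_continuous _ _ _ _ _ x)
                                  (@fib2_continuous _ _ _ _ _ _)).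
Qed.

(** [coord_nerve_mul] solved for the coordinate of the product. *)
Lemma nerve_mul_continuous : continuous (nerve_mul s).
Proof.
apply: ncont_continuous => x; set z := nerve2_base x.
have [q [cq cdq]] := delta_chart c2 hL z c1.1 (sd2_continuous cS).
pose o1 : 'I_3 := lift ord0 ord0.
pose u (x : nerve2 L) := u1_mul (u1_mul (coord q (fib2 (fib1 x)))
  (coord q (fib2 (fib2 x))))
  (u1_inv (coord (delta_sec (sd2 S) q) (s (nerve2_base x)))).
have cb := continuous_ncont x nerve2_base_continuous.
have cp := prj_continuous hL.
have pd := principal_delta c2 hL (sd2_continuous cS).
have cu : ncont u x.
  apply: ncont_u1_mul; first apply: ncont_u1_mul.
  - apply: (ncont_comp (continuous_ncont x nerve2_fst_continuous)).
    apply: chart_coord => //; rewrite -fib_eq; exact: cq.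
  - apply: (ncont_comp (continuous_ncont x nerve2_snd_continuous)).
    apply: chart_coord => //; rewrite -fib_eq.
    by rewrite -[fib1 _]/(prj (pull (sd2 S _) L) _) -(fib_eq x); exact: cq.
  - apply: ncont_u1_inv.
    apply: (ncont_comp (ncont_comp cb (continuous_ncont _ cs))).
    by apply: (chart_coord (prj_continuous pd)); rewrite secK.
have c : ncont (fun x => uact (u x) (q (sd2 S o1 (nerve2_base x)))) x.
  apply: (ncont_uact cgh_nerve2 hL cu).
  apply: (ncont_comp (f := sd2 S o1 \o @nerve2_base _ _ _ _ S L)).
    exact: (ncont_comp cb (continuous_ncont _ (@sd2_continuous _ _ _ _ cS o1))).
  exact: (chart_ncont (cq o1)).
apply: ncont_ext c; apply: filterE => w.
apply/esym; rewrite {1}(coordP q (nerve_mul s w)) -nerve_mul_proj.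
congr uact; rewrite /u coord_nerve_mul /= /nerve_sd2 /=.
exact: u1_mul_solve.
Qed.

Lemma nerve_sd2_continuous i : continuous (@nerve_sd2 _ _ _ _ S L s i).
Proof.
case: i => [[|[|i]] hi].
- exact: nerve2_fst_continuous.
- exact: nerve_mul_continuous.
- exact: nerve2_snd_continuous.
Qed.

Lemma nerve_sd3_continuous i : continuous (@nerve_sd3 _ _ _ _ S hS L s i).
Proof.
have c23 : continuous (@nerve3_23 _ _ _ _ S L).
  move=> x; exact: (continuous_comp (@fib1_continuous _ _ _ _ _ x)
                                    (@fib2_continuous _ _ _ _ _ _)).
have c12 : continuous (@nerve3_12 _ _ _ _ S L).
  move=> x; apply: (continuous_comp (f := fun x : nerve3 L => fib1 (fib2 x))).
    exact: (continuous_comp (@fib2_continuous _ _ _ _ _ x)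
                            (@fib1_continuous _ _ _ _ _ _)).
  exact: fib2_continuous.
have c01 : continuous (@nerve3_01 _ _ _ _ S L).
  move=> x; apply: (continuous_comp (f := fun x : nerve3 L => fib2 (fib2 x))).
    exact: (continuous_comp (@fib2_continuous _ _ _ _ _ x)
                            (@fib2_continuous _ _ _ _ _ _)).
  exact: fib2_continuous.
have cb j : continuous (fun x : nerve3 L => sd3 S j (nerve3_base x)).
  move=> x; exact: (continuous_comp (@nerve3_base_continuous x)
                                    (@sd3_continuous _ _ _ _ cS j _)).
(* a map into [N(L)_2] is determined by its base point and two edges *)
have pt (h : nerve3 L -> nerve2 L) j :
    (forall x, nerve2_base (h x) = sd3 S j (nerve3_base x)) ->
    continuous (fun x => fib2 (fib1 (h x))) ->
    continuous (fun x => fib2 (fib2 (h x))) -> continuous h.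
  move=> hb ch1 ch2.
  have cbh : continuous (fun x => nerve2_base (h x)).
    by have -> : (fun x => nerve2_base (h x)) = _ := funext hb.
  apply: (continuous_fibprod cgh_nerve3).
    exact: (continuous_fibprod cgh_nerve3 cbh ch1).
  apply: (continuous_fibprod cgh_nerve3) => //.
  have -> : (fun x => fib1 (fib2 (h x))) = fun x => nerve2_base (h x).
    by apply: funext => x; exact: (esym (fib_eq (h x))).
  exact: cbh.
have d0 : continuous (@nerve3_d0 _ _ _ _ S hS L) by apply: (pt _ ord0).
have d3 : continuous (@nerve3_d3 _ _ _ _ S L).
  by apply: (pt _ (lift ord0 (lift ord0 (lift ord0 ord0)))).
case: i => [[|[|[|i]]] hi]; rewrite /nerve_sd3 /=.
- exact: d0.
- apply: (pt _ (lift ord0 ord0)) => // x.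
  exact: (continuous_comp (d3 x) (@nerve_mul_continuous _)).
- apply: (pt _ (lift ord0 (lift ord0 ord0))) => // x.
  exact: (continuous_comp (d0 x) (@nerve_mul_continuous _)).
- exact: d3.
Qed.

Lemma nerve2_base_cover : is_cover (@nerve2_base _ _ _ _ S L).
Proof.
apply: coverI => //; [exact: cgh_nerve2 | exact: nerve2_base_continuous | ].
move=> z; have [q [cq _]] := delta_chart c2 hL z c1.1 (sd2_continuous cS).
have e i w : sd2 S i w = prj L (q (sd2 S i w)) by rewrite secK.
have cz : ncont (id : ss2 S -> ss2 S) z.
  by apply: continuous_ncont => w; exact: cvg_id.
have cqi i : ncont (fun z => q (sd2 S i z)) z.
  apply: (ncont_comp (f := sd2 S i)).
    exact: (continuous_ncont _ (@sd2_continuous _ _ _ _ cS i)).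
  exact: chart_ncont.
exists (fun z => nerve2_pt (e _ z) (e _ z)); split; last exact: filterE.
by apply: (ncont_fibprod c2); apply: (ncont_fibprod c2) => //; exact: cqi.
Qed.

Lemma nerve3_base_cover : is_cover (@nerve3_base _ _ _ _ S L).
Proof.
apply: coverI => //; [exact: cgh_nerve3 | exact: nerve3_base_continuous | ].
move=> z; have [q cq] := common_chart
  [:: edge01 z; edge12 z; edge23 z] c1.1 hL.
have e (d : ss3 S -> ss1 S) w : d w = prj L (q (d w)) by rewrite secK.
have cz : ncont (id : ss3 S -> ss3 S) z.
  by apply: continuous_ncont => w; exact: cvg_id.
have ce j i : continuous (fun w => sd2 S i (sd3 S j w)).
  move=> w; exact: (continuous_comp (@sd3_continuous _ _ _ _ cS j w)
                                    (@sd2_continuous _ _ _ _ cS i _)).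
have cqe (d : ss3 S -> ss1 S) : continuous d ->
    d z \in [:: edge01 z; edge12 z; edge23 z] -> ncont (fun w => q (d w)) z.
  move=> cd dz; apply: (ncont_comp (f := d)); first exact: continuous_ncont.
  exact/chart_ncont/cq.
exists (fun w => @fpair _ _ _ (prj (pull (@edge23 _ _ _ S) L))
    (fun ba : fibprod (prj (pull (@edge12 _ _ _ S) L))
                      (prj (pull (@edge01 _ _ _ S) L)) =>
       prj (pull (@edge12 _ _ _ S) L) (fib1 ba))
    (fpair (e _ w))
    (@fpair _ _ _ (prj (pull (@edge12 _ _ _ S) L))
       (prj (pull (@edge01 _ _ _ S) L)) (fpair (e _ w)) (fpair (e _ w)) erefl)
    erefl); split; last exact: filterE.
apply: (ncont_fibprod c3).
  apply: (ncont_fibprod c3) => //; apply: cqe; first exact: ce.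
  by rewrite !inE eqxx !orbT.
apply: (ncont_fibprod c3).
  apply: (ncont_fibprod c3) => //; apply: cqe; first exact: ce.
  by rewrite !inE eqxx !orbT.
apply: (ncont_fibprod c3) => //; apply: cqe; first exact: ce.
by rewrite !inE eqxx.
Qed.

Lemma nerve_ss_cover : delta_sec (sd3 S) s =1 delta_one (sd3 S) (sd2 S) L ->
  is_ss_cover (nerve hS s).
Proof.
move=> s_one; split.
- exact: nerve_simplicial.
- move=> i; have c : continuous (sd1 S i \o prj L).
    move=> x; apply: continuous_comp; first exact: (prj_continuous hL).
    exact: (@sd1_continuous _ _ _ _ cS i).
  exact: c.
- exact: nerve_sd2_continuous.
- exact: nerve_sd3_continuous.
- exact: (pi0_cover cS).
- exact: (cover_comp (principal_cover c1 hL) (pi1_cover cS)).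
- exact: (cover_comp nerve2_base_cover (pi2_cover cS)).
- exact: (cover_comp nerve3_base_cover (pi3_cover cS)).
Qed.
End NerveTheory.

(** * Pulling back a rigid bundle 2-gerbe *)

Section HVFaces.
Variables (Y X : topologicalType) (y : Y -> X) (S : ss_over y).
Hypothesis cS : is_ss_cover S.

Lemma cgh_pow1 k : cgh (fibpow (pi1 S) k).
Proof. by apply: cgh_fibpow; case: (pi1_cover cS) => -[]. Qed.
Lemma cgh_pow2 k : cgh (fibpow (pi2 S) k).
Proof. by apply: cgh_fibpow; case: (pi2_cover cS) => -[]. Qed.
Lemma cgh_pow0 k : cgh (fibpow (pi0 S) k).
Proof. by apply: cgh_fibpow; case: (pi0_cover cS) => -[]. Qed.

Lemma vface1_continuous k i : continuous (@vface1 _ _ _ S k i).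
Proof. by apply: fpface_continuous; case: (pi1_cover cS) => -[]. Qed.
Lemma hface1_continuous k i : continuous (@hface1 _ _ _ S k i).
Proof.
apply: fpmap_continuous; last exact: (sd1_continuous cS).
by case: (pi1_cover cS) => -[].
Qed.
Lemma hface2_continuous k i : continuous (@hface2 _ _ _ S k i).
Proof.
apply: fpmap_continuous; last exact: (sd2_continuous cS).
by case: (pi2_cover cS) => -[].
Qed.

Lemma hface12_id k : simplicial_id (@hface1 _ _ _ S k) (@hface2 _ _ _ S k).
Proof.
move=> i j1 i' j ij ei ej a; apply: fibpow_inj => l.
exact: (ss_simplicial cS).1.
Qed.
Lemma hface23_id k : simplicial_id (@hface2 _ _ _ S k) (@hface3 _ _ _ S k).
Proof.
move=> i j1 i' j ij ei ej a; apply: fibpow_inj => l.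
exact: (ss_simplicial cS).2.
Qed.
End HVFaces.

Arguments cgh_pow0 {Y X y S} cS k.
Arguments cgh_pow1 {Y X y S} cS k.
Arguments hface1_continuous {Y X y S} cS k i _.

Lemma fpface1_id (A B : topologicalType) (f : A -> B) :
  simplicial_id (@fpface1 _ _ f) (@fpface _ _ f 2).
Proof.
move=> i j1 i' j ij ei ej a; apply: (congr1 (fun b => fpev b ord0)).
exact: (@fpface_id _ _ _ 1).
Qed.

Section MapPowers.
Variables (Y X : topologicalType) (y : Y -> X) (S' S : ss_over y).
Variable f : ss_map S' S.
Hypothesis cS' : is_ss_cover S'.

Lemma smpow1_continuous k : continuous (sm1 f) -> continuous (@smpow1 _ _ _ _ _ f k).
Proof. by apply: fpmap_continuous => //; case: (pi1_cover cS') => -[]. Qed.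
Lemma smpow2_continuous k : continuous (sm2 f) -> continuous (@smpow2 _ _ _ _ _ f k).
Proof. by apply: fpmap_continuous => //; case: (pi2_cover cS') => -[]. Qed.
End MapPowers.

Section PullGerbeTheory.
Context {R : realType} {Y X : topologicalType} {y : Y -> X}.
Variables (G : rigid2gerbe R y) (S' : ss_over y) (f : ss_map S' (rZ G)).
Hypotheses (hG : is_rigid2gerbe G) (cS' : is_ss_cover S').
Hypotheses (f0 : continuous (sm0 f)) (f1 : continuous (sm1 f)).
Hypotheses (f2 : continuous (sm2 f)) (f3 : continuous (sm3 f)).

Let G' := pull_gerbe f.
Let cS := rigid_ss_cover hG.
Let hE : principal (rE G). Proof. by have [] := rigid_gerbe hG. Qed.
Let e := some_section (rE G).
Let e' : section (rE G') := pull_sec (@smpow1 _ _ _ _ _ f 2) e.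

Lemma pull_principal : principal (rE G').
Proof. exact: (principal_pull (cgh_pow1 cS' 2) (smpow1_continuous cS' f1) hE). Qed.

Lemma pull_m_continuous : continuous (rm G').
Proof.
apply: lift_delta_continuous => //; try exact: cgh_pow1.
- by apply: smpow1_continuous.
- by apply: smpow1_continuous.
- by move=> i; exact: vface1_continuous.
- by move=> i; exact: vface1_continuous.
- by have [] := rigid_gerbe hG.
Qed.

Lemma pull_M_continuous : continuous (rM G').
Proof.
apply: lift_delta_continuous => //; try exact: cgh_pow1; try exact: cgh_pow2.
- by apply: smpow2_continuous.
- by apply: smpow1_continuous.
- by move=> i; exact: hface2_continuous.
- by move=> i; exact: hface2_continuous.
- exact: rigid_M_continuous.
Qed.

(** Pulling back the bundle and the reference section pulls back coordinates. *)
Lemma coord_pull_m :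
  (fun z => coord (delta_sec (@vface1 _ _ _ S' 2) e') (rm G' z)) =
  (fun z => coord (delta_sec (@vface1 _ _ _ (rZ G) 2) e) (rm G (smpow1 f z))).
Proof.
by apply: funext => z; apply: coord_lift_sec => w; apply: bmap_delta_sec.
Qed.

Lemma coord_pull_M :
  (fun z => coord (delta_sec (@hface2 _ _ _ S' 2) e') (rM G' z)) =
  (fun z => coord (delta_sec (@hface2 _ _ _ (rZ G) 2) e) (rM G (smpow2 f z))).
Proof.
by apply: funext => z; apply: coord_lift_sec => w; apply: bmap_delta_sec.
Qed.

Definition smpow3 k : fibpow (pi3 S') k -> fibpow (pi3 (rZ G)) k :=
  @fpmap _ _ _ _ (pi3 S') (pi3 (rZ G)) (sm3 f) id (sm_pi3 f) k.

(** By [coord_pull_m] and [coord_pull_M], each equation is, in coordinates, the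
    corresponding equation for [G] evaluated at the image point. *)
Lemma pull_gerbe_rigid : is_rigid2gerbe G'.
Proof.
split.
- exact: (rigid_cover hG).
- exact: cS'.
- split.
  + exact: (pi1_cover cS').
  + exact: pull_principal.
  + exact: pull_m_continuous.
  move=> z; apply: (coord_inj (s := delta_sec (@vface1 _ _ _ S' 3)
    (delta_sec (@vface1 _ _ _ S' 2) e'))); first by rewrite !secK.
  rewrite [RHS]coord_delta_one; last exact: fpface_id.
  rewrite [LHS]coord_delta_sec coord_pull_m.
  rewrite (delta_fun_map (h := @smpow1 _ _ _ _ _ f 4)
    (d' := @vface1 _ _ _ (rZ G) 3) (g := @smpow1 _ _ _ _ _ f 3)
    true (fun x => coord (delta_sec (@vface1 _ _ _ (rZ G) 2) e) (rm G x)));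
    last by move=> i a; exact: smpow1_vface.
  have [_ _ _ mE] := rigid_gerbe hG.
  rewrite -coord_delta_sec mE coord_delta_one //; exact: fpface_id.
- exact: pull_M_continuous.
- move=> z; apply: (coord_inj (s := delta_sec (@hface2 _ _ _ S' 3)
    (delta_sec (@vface1 _ _ _ S' 2) e'))); first by rewrite bmap_proj !secK.
  rewrite coord_delta_swap; last by move=> i j w; exact: fibpow_inj.
  rewrite !coord_delta_sec.
  rewrite coord_pull_M coord_pull_m.
  rewrite (delta_fun_map (h := @smpow2 _ _ _ _ _ f 3)
    (d' := @vface2 _ _ _ (rZ G) 2) (g := @smpow2 _ _ _ _ _ f 2)
    true (fun x => coord (delta_sec (@hface2 _ _ _ (rZ G) 2) e) (rM G x)));
    last by move=> i a; exact: fibpow_inj.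
  rewrite (delta_fun_map (h := @smpow2 _ _ _ _ _ f 3)
    (d' := @hface2 _ _ _ (rZ G) 3) (g := @smpow1 _ _ _ _ _ f 3)
    true (fun x => coord (delta_sec (@vface1 _ _ _ (rZ G) 2) e) (rm G x)));
    last by move=> i a; exact: smpow2_hface.
  have := congr1 (coord (delta_sec (@hface2 _ _ _ (rZ G) 3)
    (delta_sec (@vface1 _ _ _ (rZ G) 2) e))) (rigid_Mm hG (smpow2 f z)).
  rewrite coord_delta_swap; last by move=> i j w; exact: fibpow_inj.
  by rewrite !coord_delta_sec.
- move=> z; apply: (coord_inj (s := delta_sec (@hface3 _ _ _ S' 2)
    (delta_sec (@hface2 _ _ _ S' 2) e'))); first by rewrite !secK.
  rewrite [RHS]coord_delta_one; last exact: hface23_id.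
  rewrite [LHS]coord_delta_sec coord_pull_M.
  rewrite (delta_fun_map (h := @smpow3 2)
    (d' := @hface3 _ _ _ (rZ G) 2) (g := @smpow2 _ _ _ _ _ f 2)
    true (fun x => coord (delta_sec (@hface2 _ _ _ (rZ G) 2) e) (rM G x)));
    last by move=> i a; apply: fibpow_inj => j; exact: sm_sd3.
  rewrite -coord_delta_sec (rigid_MM hG) coord_delta_one //.
  exact: hface23_id.
Qed.

Lemma pull_gerbe_mor_rigid : is_rigid_mor (pull_gerbe_mor f).
Proof.
split.
- exact: f0.
- exact: f1.
- exact: f2.
- exact: f3.
- exact: fib2_continuous.
- by move=> z; exact: lift_ptK.
- by move=> z; exact: lift_ptK.
Qed.
End PullGerbeTheory.

(** * The rigid trivialisation of [r_1(B, t)] *)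

Section R1Theory.
Context {R : realType} {X : topologicalType}.
Variables (B : bigerbe R X) (t : bitriv B).
Hypotheses (hB : is_bigerbe B) (ht : is_bitriv t).

Let S := bsq_over B.
Let N := r1t_nerve t.
Let h2 := @smpow1 _ _ _ _ _ (r1t_map t) 2.
Let h3 := @smpow1 _ _ _ _ _ (r1t_map t) 3.
Let k2 := @smpow2 _ _ _ _ _ (r1t_map t) 2.

Lemma bigerbe_ss_cover : is_ss_cover S.
Proof.
exact: (bsq_ss_cover (bw1_cover hB) (by1_cover hB) (by2_cover hB)
  (bW12_cover hB)).
Qed.

Lemma r1_rigid : is_rigid2gerbe (r1 B).
Proof.
split.
- exact: (by1_cover hB).
- exact: bigerbe_ss_cover.
- split.
  + exact: (pi1_cover bigerbe_ss_cover).
  + exact: (bE_principal hB).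
  + exact: (bs_continuous hB).
  + exact: (b_ss hB).
- exact: (bM_continuous hB).
- exact: (b_Ms hB).
- exact: (b_MM hB).
Qed.

Lemma r1t_nerve_cover : is_ss_cover N.
Proof.
exact: (nerve_ss_cover _ bigerbe_ss_cover (bQ2_principal ht)
  (bt2_continuous ht) (bt2_one ht)).
Qed.

Lemma r1t_map_continuous : [/\ continuous (sm0 (r1t_map t)),
  continuous (sm1 (r1t_map t)), continuous (sm2 (r1t_map t)) &
  continuous (sm3 (r1t_map t))].
Proof.
split.
- by move=> x; exact: cvg_id.
- exact: (prj_continuous (bQ2_principal ht)).
- exact: nerve2_base_continuous.
- exact: nerve3_base_continuous.
Qed.

Section Coordinates.
Variables (e : section (bE B)) (q : section (bQ2 t)) (f : section (bQ1 t)).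
Let e' : section (rE (r1t t)) := pull_sec h2 e.

(** The coefficient of [bphi] relative to the sections [e], [q] and [f]. *)
Let v x := coord (delta_sec (@hface1 _ _ _ S 2) f)
  (bphi t (tens_sec e (delta_sec (@vface1_base _ _ _ S) q) x)).

Lemma coord_r1t_can z : coord (delta_sec (@vface1_base _ _ _ S) q) (r1t_can z) =
  delta_fun true (@vface1_base _ _ _ N) (coord q) z.
Proof. by rewrite /delta_sec /= coord_tens coord_dual !coord_pull. Qed.

(** The second factor is the contribution of the canonical trivialisation of the
    pullback of [delta_v Q_2]. *)
Lemma coord_r1t_iso z :
  coord (delta_sec (@hface1 _ _ _ N 2) f) (rt_iso (r1t_triv t) (e' z)) =
  u1_mul (v (h2 z)) (delta_fun true (@vface1_base _ _ _ N) (coord q) z).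
Proof.
rewrite -coord_r1t_can.
set F := bmap_delta (h := h2) (g := id) (d := @hface1 _ _ _ N 2)
  (d' := @hface1 _ _ _ S 2) (r1t_hface (t := t)) (bmap_id (bQ1 t)).
have Ff w : F (delta_sec (@hface1 _ _ _ N 2) f w) =
    delta_sec (@hface1 _ _ _ S 2) f (h2 w) by apply: bmap_delta_sec.
rewrite -(coord_bmap _ Ff).
have -> : F (rt_iso (r1t_triv t) (e' z)) = r1t_phi_fun (e' z) by exact: lift_ptK.
rewrite /r1t_phi_fun.
have -> : tpure (r1t_phi_subproof (e' z)) =
    uact (coord (delta_sec (@vface1_base _ _ _ S) q) (r1t_can z))
      (tens_sec e (delta_sec (@vface1_base _ _ _ S) q) (h2 z)).
  apply: (coord_inj (s := tens_sec e (delta_sec (@vface1_base _ _ _ S) q))).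
    by rewrite prj_act [RHS]secK; apply: (etrans (prj_tpure _)); exact: secK.
  rewrite coord_act coord_sec u1_mul1 coord_tens.
  have -> : coord e (fib2 (e' z)) = u1_one by exact: coord_sec.
  by rewrite u1_1mul.
by rewrite bmap_act coord_act u1_mulC.
Qed.
End Coordinates.

Lemma r1t_iso_continuous : continuous (rt_iso (r1t_triv t)).
Proof.
have cN := r1t_nerve_cover; have cS := bigerbe_ss_cover.
have [_ c1 _ _] := r1t_map_continuous.
have ch2 : continuous h2 := smpow1_continuous cN c1.
have cNN := cgh_pow1 cN 2; have cSS := cgh_pow1 cS 2.
have hQ1 := bQ1_principal ht; have hE := bE_principal hB.
have hQ2 := bQ2_principal ht.
apply: bmap_continuous.
- exact: (principal_pull cNN ch2 hE).
- exact: (principal_delta cNN hQ1 (hface1_continuous cN 2)).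
move=> z; have [e ce] := principal_chart (h2 z) hE.
have hS1 : hausdorff_space (ss1 S) by case: (pi1_cover cS) => -[].
have [q [cq cdq]] := delta_chart cSS hQ2 (h2 z) hS1 (@fpface1_continuous _ _ _).
have [f [cf cdf]] := delta_chart cSS hQ1 (h2 z) (cgh_pow0 cS 2).1
  (hface1_continuous cS 2).
have cdfN : chart (delta_sec (@hface1 _ _ _ N 2) f) z.
  apply: (chart_delta cNN hQ1 (hface1_continuous cN 2)) => i.
  have <- : hface1 (S := S) i (h2 z) = hface1 (S := N) i z by exact: r1t_hface.
  exact: cf.
exists (pull_sec h2 e); first exact: chart_pull.
pose v x := coord (delta_sec (@hface1 _ _ _ S 2) f)
  (bphi t (tens_sec e (delta_sec (@vface1_base _ _ _ S) q) x)).
have cv : ncont v (h2 z).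
  have cs := chart_tens cSS hE
    (principal_delta cSS hQ2 (@fpface1_continuous _ _ _)) ce cdq.
  have cp := prj_continuous (principal_delta cSS hQ1 (hface1_continuous cS 2)).
  apply: (ncont_comp (ncont_comp (chart_ncont cs)
    (continuous_ncont _ (bphi_iso ht).1))).
  apply: (chart_coord cp).
  suff -> : prj _ (bphi t (tens_sec e (delta_sec (@vface1_base _ _ _ S) q) (h2 z)))
      = h2 z by [].
  exact: (etrans (bmap_proj _ _) (secK _ _)).
have c : ncont (fun w => uact (u1_mul (v (h2 w))
    (delta_fun true (@vface1_base _ _ _ N) (coord q) w))
    (delta_sec (@hface1 _ _ _ N 2) f w)) z.
  apply: (ncont_uact cNN (principal_delta cNN hQ1 (hface1_continuous cN 2)) _
    (chart_ncont cdfN)).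
  apply: ncont_u1_mul; first exact: (ncont_comp (continuous_ncont z ch2) cv).
  apply: ncont_delta_fun => i; first exact: fpface1_continuous.
  apply: (chart_coord (prj_continuous hQ2)); exact: cq.
apply: ncont_ext c; apply: filterE => w.
rewrite -coord_r1t_iso; apply/esym.
rewrite [LHS](coordP (delta_sec (@hface1 _ _ _ N 2) f)); congr uact.
suff -> : prj _ (rt_iso (r1t_triv t) (pull_sec h2 e w)) = w by [].
exact: (etrans (bmap_proj _ _) (secK _ _)).
Qed.

(** With the coefficient of [coord_r1t_iso], the two compatibility conditions
    become those on the trivialisation of the bigerbe: vertically, the additional
    factor [delta_v (delta_v k)], where [k] is [coord q], is 1; horizontally,
    [delta_h (delta_v k)] is [delta_v] of the coordinate of [t_2]. *)
Lemma r1t_triv_rigid : is_rigid_triv (r1t_triv t).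
Proof.
have cN := r1t_nerve_cover; have cS := bigerbe_ss_cover.
have [_ c1 _ _] := r1t_map_continuous.
have ch2 : continuous h2 := smpow1_continuous cN c1.
pose e := some_section (bE B); pose q := some_section (bQ2 t).
pose f := some_section (bQ1 t); pose e' : section (rE (r1t t)) := pull_sec h2 e.
pose v x := coord (delta_sec (@hface1 _ _ _ S 2) f)
  (bphi t (tens_sec e (delta_sec (@vface1_base _ _ _ S) q) x)).
have isoE : (fun z => coord (delta_sec (@hface1 _ _ _ N 2) f)
      (rt_iso (r1t_triv t) (e' z))) =
    fun z => u1_mul (v (h2 z)) (delta_fun true (@vface1_base _ _ _ N) (coord q) z).
  by apply: funext => z; exact: coord_r1t_iso.
split.
- split.
  + exact: (bw1_cover hB).
  + exact: (bQ1_principal ht).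
  + exact: (bt1_continuous ht).
  + exact: (bt1_one ht).
- apply: bmap_bundle_iso.
  + exact: (cgh_pow1 cN 2).
  + exact: (principal_pull (cgh_pow1 cN 2) ch2 (bE_principal hB)).
  + exact: (principal_delta (cgh_pow1 cN 2) (bQ1_principal ht) (hface1_continuous cN 2)).
  + exact: r1t_iso_continuous.
- move=> z; apply: (coord_inj (s := delta_sec (@hface1 _ _ _ N 3)
    (delta_sec (@vface0 _ _ _ N 2) f))); first by rewrite !bmap_proj !secK.
  rewrite coord_delta_swap; last by move=> i j w; exact: fibpow_inj.
  rewrite (coord_bmap_delta_id _ e') secK isoE delta_funM.
  rewrite (delta_fun_map (h := h3) (d' := @vface1 _ _ _ S 2) (g := h2) true v);
    last by move=> i a; exact: fibpow_inj.
  rewrite delta_fun_one; last exact: fpface1_id.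
  rewrite u1_mul1 [X in u1_mul X _](congr1 (@^~ z) (coord_pull_m _)).
  rewrite [RHS]coord_delta_sec.
  have hh i a : hface1 (S := S) i (h3 a) = hface1 (S := N) i a.
    by apply: (@fibpow_inj _ _ (pi0 S)) => j; rewrite !fpev_map.
  rewrite [RHS](delta_fun_map true
    (fun x => coord (delta_sec (@vface0 _ _ _ N 2) f) (bt1 t x)) z hh).
  have := congr1 (coord (delta_sec (@hface1 _ _ _ S 3)
    (delta_sec (@vface0 _ _ _ S 2) f))) (bphi_s ht (h3 z)).
  rewrite coord_delta_swap; last by move=> i j w; exact: fibpow_inj.
  rewrite (coord_bmap_delta_id _ (tens_sec e (delta_sec (@vface1_base _ _ _ S) q))).
  rewrite bmap_proj secK coord_delta_tens coord_tens_sec.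
  rewrite (coord_delta_one q _ (@fpface1_id _ _ (pi1 S))).
  by rewrite u1_mul1 [RHS]coord_delta_sec.
- move=> z; apply: (coord_inj (s := delta_sec (@hface2 _ _ _ N 2)
    (delta_sec (@hface1 _ _ _ N 2) f))); first by rewrite !bmap_proj !secK.
  rewrite coord_delta_one; last exact: hface12_id.
  rewrite (coord_bmap_delta_id _ e') secK isoE delta_funM.
  rewrite (delta_fun_map (h := k2) (d' := @hface2 _ _ _ S 2) (g := h2) true v);
    last exact: (@smpow2_hface _ _ _ _ _ (r1t_map t) 2).
  (* exchange the directions to reach [delta_h k], which is [t_2] *)
  rewrite (delta_fun_swap (h' := @vface2_base _ _ _ N) (v := sd2 N)); last by [].
  have -> : delta_fun true (sd2 N) (coord q) = fun x =>
      coord (delta_sec (sd2 S) q) (bt2 t (nerve2_base x)).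
    by apply: funext => x; rewrite coord_nerve_mul.
  rewrite (delta_fun_map (h := k2) (d' := @vface2_base _ _ _ S)
    (g := @nerve2_base _ _ _ _ S (bQ2 t)) true
    (fun x => coord (delta_sec (sd2 S) q) (bt2 t x))); last by [].
  rewrite [X in u1_mul X _](congr1 (@^~ z) (coord_pull_M _)).
  have := congr1 (coord (delta_sec (@hface2 _ _ _ S 2)
    (delta_sec (@hface1 _ _ _ S 2) f))) (bphi_M ht (k2 z)).
  rewrite coord_delta_one; last exact: hface12_id.
  rewrite (coord_bmap_delta_id _ (tens_sec e (delta_sec (@vface1_base _ _ _ S) q))).
  rewrite bmap_proj secK coord_delta_tens coord_tens_sec bmap_secE.
  rewrite coord_delta_swap; last by [].
  rewrite coord_delta_sec => <-.
  by rewrite -u1_mulA; congr u1_mul; rewrite u1_mulC.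
Qed.
End R1Theory.

Theorem propositionB5 (R : realType) (X : topologicalType)
    (B : bigerbe R X) (t : bitriv B) :
  is_bigerbe B -> is_bitriv t ->
  [/\ is_rigid2gerbe (r1t t), is_rigid_triv (r1t_triv t),
      is_rigid2gerbe (r1 B) & is_rigid_mor (r1t_mor t)].
Proof.
move=> hB ht; have [c0 c1 c2 c3] := r1t_map_continuous ht.
have hr1 := r1_rigid hB; have cN := r1t_nerve_cover hB ht.
split.
- exact: (pull_gerbe_rigid hr1 cN c1 c2).
- exact: (r1t_triv_rigid hB ht).
- exact: hr1.
- exact: (@pull_gerbe_mor_rigid _ _ _ _ (r1 B) _ (r1t_map t) c0 c1 c2 c3).
Qed.
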